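(* Let $\theta\in(0,2\pi/3)$ and let $\mu_\theta$ be the limit measure of the group $\Gamma_\theta$ generated by the reflections in the three symmetrically placed geodesics of opening angle $\theta$ (the ''symmetric pair of pants''). Its moments $c_s^{(\theta)}=\int_{S^1}z^{-s}\,d\mu_\theta$, $s\in\mathbb{Z}$, satisfy, for every integer $j$, $$c_{3j-1}^{(\theta)}=c_{3j+1}^{(\theta)}=0$$ and $$c_{3j}^{(\theta)}=(-1)^j\,\lim_{\epsilon\to 0}\,\sum_{0\le l\le M(\epsilon)/6} 6\,m_l^{(\epsilon)}\cos\bigl[3j\,\phi_l^{(\epsilon)}\bigr],$$ where $\phi_l^{(\epsilon)}$ and $m_l^{(\epsilon)}$ are the angles and weights, modulo the 6-fold symmetry, of the sample points produced by McMullen's algorithm for $\Gamma_\theta$ with parameter $\epsilon$.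
   Context: The group. $\mathbb{D}$ is the Poincaré unit disk with hyperbolic distance $d(\cdot,\cdot)$, $S^1=\partial\mathbb{D}$. Let $\zeta_6=e^{2\pi i/6}$. For $\theta\in(0,2\pi/3)$ let $g_0,g_1,g_2$ be the geodesics of $\mathbb{D}$ with end points $\zeta_6^{2j+1}e^{\pm i\theta/2}$, $j=0,1,2$; let $C_l$ be the Euclidean circle (orthogonal to $S^1$) carrying $g_l$, $D_l$ the closed disk bounded by $C_l$ (these are pairwise disjoint), $\rho_l$ the Euclidean reflection (inversion) in $C_l$, and $\Gamma_\theta=\langle\rho_0,\rho_1,\rho_2\rangle$. The limit set is $\Lambda_\infty(\theta)=\overline{\Gamma_\theta\cdot p}\cap S^1$ (independent of $p\in\mathbb{D}$). For $\gamma\in\Gamma_\theta$, $|\gamma'|$ is the absolute value of the derivative of $\gamma:S^1\to S^1$ with respect to angle. Limit measure. Let $\delta$ be the critical exponent of $\sum_{\gamma}e^{-s\,d(x,\gamma y)}$, summed over the orientation-preserving elements $\gamma$ of $\Gamma_\theta$ (convergent for $s>\delta$, divergent for $s<\delta$); it equals $\dim_H\Lambda_\infty(\theta)$. The limit measure $\mu_\theta$ is the unique probability measure supported on $\Lambda_\infty(\theta)$ such that $\int f\,d\mu_\theta=\int (f\circ\gamma)|\gamma'|^{\delta}\,d\mu_\theta$ for all $\gamma\in\Gamma_\theta$ and all continuous $f:S^1\to\mathbb{C}$. Cells. The cells of generation $0$ (primitive cells) are $D_0,D_1,D_2$; the cells of generation $1$ are $\rho_s(D_l)$, $s\ne l$;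 the cells of generation $n+1$ are obtained by reflecting all cells of generation $n$ in all primitive circles $C_s$ whose disk $D_s$ does not contain them. Every cell of generation $n$ contains exactly two cells of generation $n+1$ (its children). McMullen's algorithm. Fix $\epsilon>0$ (small). Start with the list of all cells of generation one and repeatedly replace every cell of radius at least $\epsilon$ by its two children, keeping cells of radius less than $\epsilon$, until all cells have radius less than $\epsilon$. Denote the final list by $P_0,\dots,P_M$, $M=M(\epsilon)$, and let $z_l=z_l^{(\epsilon)}\in S^1$ be the radial projection to $S^1$ of the Euclidean centre of $P_l$. Let $p(i)$ be the index of the primitive cell containing $P_i$; write $i\mapsto j$ if $P_j\subset\rho_{p(i)}(P_i)$. Let $T$ be the matrix with $T_{ij}=|\rho_{p(i)}'(\rho_{p(i)}(z_j))|^{-1}$ if $i\mapsto j$ and $T_{ij}=0$ otherwise; for $d>0$, $T^d$ is the matrix of entrywise $d$-th powers (a primitive non-negative matrix). Let $d_\epsilon$ be the unique positive number such that $T^{d_\epsilon}$ has spectral radius $1$, and let $w^{(\epsilon)}$ be its Perron–Frobenius (right) eigenvector, $T^{d_\epsilon}w^{(\epsilon)}=w^{(\epsilon)}$, with positive entries normalized by $\sum_l w_l^{(\epsilon)}=1$. Symmetry reduction. The sample points and weights are invariant under the 6-fold symmetry generated by $z\mapsto\bar z$ and $z\mapsto e^{\pm 2\pi i/3}z$. Hence the $M+1$ points $z_l^{(\epsilon)}$ can be written as $\zeta_6^{2j+1}e^{\pm i\phi_l^{(\epsilon)}}$ with $j\in\{0,1,2\}$ and $l$ ranging over the integers $0\le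 l\le M(\epsilon)/6$, where $0<\phi_0^{(\epsilon)}<\phi_1^{(\epsilon)}<\cdots<\theta/2$; for each such $l$ the six points $\zeta_6^{2j+1}e^{\pm i\phi_l^{(\epsilon)}}$ have the same entry of $w^{(\epsilon)}$, denoted $m_l^{(\epsilon)}>0$. *)

(* Defs.v *)
From HB Require Import structures.
From mathcomp Require Import all_boot all_order all_algebra.
From mathcomp Require Import all_classical all_reals all_analysis.
From mathcomp Require Import complex ring lra.

Set Implicit Arguments.
Unset Strict Implicit.
Unset Printing Implicit Defensive.

Import Order.TTheory GRing.Theory Num.Theory numFieldNormedType.Exports.

Local Open Scope classical_set_scope.
Local Open Scope ring_scope.
Local Open Scope complex_scope.

(* R[i] carries no topology in the libraries; it is given the one that
   MathComp-Analysis puts on every numClosedFieldType (by the norm). *)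
HB.instance Definition _ (R : realType) :=
  NormedModule.copy R[i] (R[i] : numClosedFieldType)^o.

Definition borelC (R : realType) := g_sigma_algebraType (@open R[i]).

(* The real-valued modulus; `|z| is a complex number. *)
Notation normc := Normc.normc.

Section complex_plane.
Context {R : realType}.
Local Notation C := (R[i]).

Definition expi (t : R) : C := cos t +i* sin t.

Definition zeta6 : C := expi (2 * pi / 6).

Definition unit_disk : set C := [set z | normc z < 1].

Definition unit_circle : set C := [set z | normc z = 1].

(* d(z,w) = 2 artanh |(z - w) / (1 - conj(w) z)|, of curvature -1. *)
Definition hyp_dist (z w : C) : R :=
  let t := normc ((z - w) / (1 - conjc w * z)) in ln ((1 + t) / (1 - t)).

(* |g'|(z) for a self-map g of the unit circle: the speed at t = 0 of the curve
   t |-> g (z e^{it}), that is |h'(0)| if g (z e^{it}) = e^{i h(t)}. *)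
Definition angular_deriv (g : C -> C) (z : C) : R :=
  normc (derive1 (fun t : R => complex.Re (g (z * expi t))) 0
         +i* derive1 (fun t : R => complex.Im (g (z * expi t))) 0).

Definition cintegral (mu : probability (borelC R) R) (A : set C) (f : C -> C)
    : C :=
  (\int[mu]_(z in A) complex.Re (f z)) +i* (\int[mu]_(z in A) complex.Im (f z)).

Definition moment (mu : probability (borelC R) R) (s : int) : C :=
  cintegral mu unit_circle (fun z => z ^ (- s)).

Definition spectral_radius n (A : 'M[R]_n) : R :=
  sup [set normc lam | lam in
        [set lam : C | eigenvalue (map_mx (fun x : R => x%:C) A) lam]].

(* A disk is a pair (centre, radius). *)
Definition disk := (C * R)%type.

Definition closed_disk (D : disk) : set C := [set z | normc (z - D.1) <= D.2].

(* Since 0^-1 = 0, the centre of D is fixed, so that this is an involution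
   of C. *)
Definition inversion (D : disk) (z : C) : C := D.1 + (D.2 ^+ 2)%:C / conjc (z - D.1).

(* The image of the disk E under the inversion in the boundary of D, when the
   centre of D is not in E; see inversion_closed_disk. *)
Definition reflect_disk (D E : disk) : disk :=
  let k := D.2 ^+ 2 / (normc (E.1 - D.1) ^+ 2 - E.2 ^+ 2) in
  (D.1 + k%:C * (E.1 - D.1), k * E.2).

Definition radial_proj (z : C) : C := z / (normc z)%:C.

End complex_plane.

Arguments disk R : clear implicits.

Lemma normc_leE (R : realType) (z : R[i]) (r : R) : 0 <= r ->
  (normc z <= r) = (complex.Re z ^+ 2 + complex.Im z ^+ 2 <= r ^+ 2).
Proof.
move=> r0; case: z => a b /=.
rewrite -{1}(ger0_norm r0) -sqrtr_sqr ler_sqrt ?sqr_ge0//.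
Qed.

Lemma normc_sqr (R : realType) (z : R[i]) :
  normc z ^+ 2 = complex.Re z ^+ 2 + complex.Im z ^+ 2.
Proof. by case: z => a b /=; rewrite sqr_sqrtr// addr_ge0 ?sqr_ge0. Qed.

Lemma inversionK (R : realType) (D : disk R) : 0 < D.2 ->
  cancel (inversion D) (inversion D).
Proof.
case: D => c r /= r0 z; rewrite /inversion /=.
have conjc_div (x y : R[i]) : conjc (x / y) = conjc x / conjc y.
  by rewrite -conjc_inv; exact: rmorphM.
rewrite [c + _ - c]addrC addKr conjc_div conjcK conjc_real.
rewrite invfM invrK mulrA mulfV ?mul1r ?subrKC//.
by rewrite fmorph_eq0 expf_neq0 ?gt_eqF.
Qed.

Lemma inversion_closed_disk_mem (R : realType) (D E : disk R) (z : R[i]) :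
  0 < D.2 -> 0 <= E.2 < normc (E.1 - D.1) ->
  closed_disk (reflect_disk D E) (inversion D z) <-> closed_disk E z.
Proof.
case: D E => c r [a s] /= r0 /andP[s0 sv].
have N0 : 0 < normc (a - c) ^+ 2 - s ^+ 2.
  by rewrite subr_gt0 ltr_pXn2r// nnegrE ltW// (le_lt_trans s0).
rewrite /closed_disk /reflect_disk /inversion /= !normc_leE//; last first.
  by rewrite mulr_ge0// divr_ge0 ?sqr_ge0// ltW.
move: N0; rewrite normc_sqr; case: z c a sv => [z1 z2] [c1 c2] [a1 a2] sv /=.
set N := (_ - s ^+ 2) => N0.
have -> : z1 - a1 = (z1 - c1) - (a1 - c1) by ring.
have -> : z2 - a2 = (z2 - c2) - (a2 - c2) by ring.
move: {sv}(z1 - c1) (z2 - c2) (a1 - c1) (a2 - c2) @N N0 => x y p q N N0.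
rewrite sqrrN; have [Q0|Q0] := eqVneq (x ^+ 2 + y ^+ 2) 0.
  move: Q0 => /eqP; rewrite paddr_eq0 ?sqr_ge0// !sqrf_eq0.
  move=> /andP[/eqP-> /eqP->].
  rewrite !(mul0r, mulr0, oppr0, subr0, addr0, sub0r, add0r).
  rewrite !opprD !addrA !subrr !add0r !sqrrN !exprMn -mulrDr.
  have k0 : 0 < (r ^+ 2) ^+ 2 * N^-1 ^+ 2.
    by rewrite mulr_gt0 ?exprn_gt0 ?invr_gt0.
  by rewrite ler_pM2l.
have Qgt0 : 0 < x ^+ 2 + y ^+ 2 by rewrite lt0r Q0 addr_ge0 ?sqr_ge0.
rewrite -subr_le0 -[in X in _ <-> X]subr_le0.
set A := (X in X <= 0 <-> _); set B := (X in _ <-> X <= 0).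
have -> : A = (r ^+ 2) ^+ 2 / ((x ^+ 2 + y ^+ 2) * N) * B.
  have N0' : p ^+ 2 + q ^+ 2 - s ^+ 2 != 0 by rewrite gt_eqF.
  by rewrite /A /B /N; field; rewrite N0' Q0.
by rewrite pmulr_rle0// divr_gt0 ?exprn_gt0// mulr_gt0.
Qed.

Lemma inversion_closed_disk (R : realType) (D E : disk R) :
  0 < D.2 -> 0 <= E.2 < normc (E.1 - D.1) ->
  inversion D @` closed_disk E = closed_disk (reflect_disk D E).
Proof.
move=> D0 DE; apply/seteqP; split => [_ [z Ez <-]|z].
  exact/inversion_closed_disk_mem.
rewrite -{1}[z](inversionK D0) => /(inversion_closed_disk_mem _ D0 DE) Ez.
by exists (inversion D z) => //; rewrite inversionK.
Qed.

Section schottky.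
Context {R : realType} (theta : R).
Local Notation C := R[i].

(* The circle C_l, which is orthogonal to the unit circle and meets it in
   zeta6^(2l+1) e^{+-i theta/2}; see primitive_disk_orthogonal and
   primitive_disk_endpoint. *)
Definition primitive_disk (l : 'I_3) : disk R :=
  (zeta6 ^+ (2 * l + 1) / (cos (theta / 2))%:C, tan (theta / 2)).

Definition reflection (l : 'I_3) : C -> C := inversion (primitive_disk l).

Definition group_word (s : seq 'I_3) : C -> C :=
  foldr (fun l g => reflection l \o g) id s.

(* The inverse of a word in the involutions rho_l is the reversed word. *)
Definition Gamma : set (C -> C) := [set group_word s | s in setT].

(* Each rho_l reverses orientation. *)
Definition Gamma_plus : set (C -> C) :=
  [set group_word s | s in [set s | ~~ odd (size s)]].

Definition limit_set (p : C) : set C :=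
  closure [set g p | g in Gamma] `&` unit_circle.

Definition poincare_series (x y : C) (s : R) : \bar R :=
  \esum_(g in Gamma_plus) (expR (- s * hyp_dist x (g y)))%:E.

Definition is_critical_exponent (delta : R) : Prop :=
  forall x y, unit_disk x -> unit_disk y -> forall s,
    (delta < s -> (poincare_series x y s < +oo)%E) /\
    (s < delta -> poincare_series x y s = +oo%E).

Definition is_limit_measure (mu : probability (borelC R) R) : Prop :=
  (forall p, unit_disk p -> mu (~` limit_set p) = 0%E) /\
  exists2 delta, is_critical_exponent delta &
    forall (g : C -> C) (f : C -> C), Gamma g ->
      {within unit_circle, continuous f} ->
      cintegral mu unit_circle f =
      cintegral mu unit_circle
        (fun z => f (g z) * (angular_deriv g z `^ delta)%:C).

Definition sub_disk (D E : disk R) : bool :=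
  `[< closed_disk D `<=` closed_disk E >].

Fixpoint generation (n : nat) : seq (disk R) :=
  if n is k.+1 then
    [seq reflect_disk (primitive_disk s) P
      | s <- enum 'I_3,
        P <- [seq P <- generation k | ~~ sub_disk P (primitive_disk s)]]
  else [seq primitive_disk s | s <- enum 'I_3].

Definition children (n : nat) (P : disk R) : seq (disk R) :=
  [seq Q <- generation n.+1 | sub_disk Q P].

(* Cells are paired with their generation. *)
Definition refine (eps : R) (L : seq (nat * disk R)) : seq (nat * disk R) :=
  flatten [seq if x.2.2 < eps then [:: x]
               else [seq (x.1.+1, Q) | Q <- children x.1 x.2] | x <- L].

Definition is_final_list (eps : R) (P : seq (disk R)) : Prop :=
  exists k, let L := iter k (refine eps) [seq (1%N, Q) | Q <- generation 1] in
    all (fun x => x.2.2 < eps) L /\ P = [seq x.2 | x <- L].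

(* The index p of the primitive cell containing P; ord0 is a dummy value. *)
Definition primitive_index (P : disk R) : 'I_3 :=
  odflt ord0 [pick s | sub_disk P (primitive_disk s)].

Definition sample_point (P : seq (disk R)) (i : 'I_(size P)) : C :=
  radial_proj (tnth (in_tuple P) i).1.

Definition mcmullen_matrix (P : seq (disk R)) : 'M[R]_(size P) :=
  \matrix_(i, j)
    let Pi := tnth (in_tuple P) i in
    let Pj := tnth (in_tuple P) j in
    let rho := reflection (primitive_index Pi) in
    if `[< closed_disk Pj `<=` rho @` closed_disk Pi >]
    then (angular_deriv rho (rho (sample_point j)))^-1 else 0.

Definition mx_power n (A : 'M[R]_n) (d : R) : 'M[R]_n :=
  map_mx (fun t => t `^ d) A.

(* zeta6^(2j+1) e^{+-i phi}, j = 0, 1, 2 *)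
Definition six_points (phi : R) : set C :=
  [set z | exists j : 'I_3, z = zeta6 ^+ (2 * j + 1) * expi phi \/
                            z = zeta6 ^+ (2 * j + 1) * expi (- phi)].

(* McMullen's algorithm with parameter eps ends with the M+1 cells P, the
   dimension d and the eigenvector w, and phi l, m l (0 <= l <= M/6) are the
   angles and weights of the sample points modulo the 6-fold symmetry. *)
Definition mcmullen_output (eps : R) (M : nat) (phi m : nat -> R) : Prop :=
  exists (P : seq (disk R)) (d : R) (w : 'cV[R]_(size P)),
    [/\ is_final_list eps P /\ size P = M.+1,
        0 < d /\ spectral_radius (mx_power (mcmullen_matrix P) d) = 1,
        [/\ mx_power (mcmullen_matrix P) d *m w = w,
            forall i, 0 < w i 0 & \sum_i w i 0 = 1],
        (forall l, (l <= M %/ 6)%N -> 0 < phi l < theta / 2) /\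
        (forall k l, (k < l <= M %/ 6)%N -> phi k < phi l) &
        [set sample_point i | i in [set: 'I_(size P)]] =
          \bigcup_(l in [set l | (l <= M %/ 6)%N]) six_points (phi l) /\
        forall i l, (l <= M %/ 6)%N -> six_points (phi l) (sample_point i) ->
          w i 0 = m l].

End schottky.

Lemma normc_expi (R : realType) (t : R) : normc (expi t) = 1.
Proof. by rewrite /expi /= cos2Dsin2 sqrtr1. Qed.

Lemma normc_zeta6X (R : realType) n : normc (zeta6 ^+ n : R[i]) = 1.
Proof.
elim: n => [|n IH]; first by rewrite expr0 Normc.normc1.
by rewrite exprS Normc.normcM IH normc_expi mulr1.
Qed.

Lemma cos_half_gt0 (R : realType) (theta : R) :
  0 < theta < 2 * pi / 3 -> 0 < cos (theta / 2).
Proof.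
move=> /andP[th0 th1]; apply: cos_gt0_pihalf; apply/andP.
have := pi_gt0 R; split; lra.
Qed.

Lemma primitive_disk_orthogonal (R : realType) (theta : R) (l : 'I_3) :
  0 < theta < 2 * pi / 3 ->
  normc (primitive_disk theta l).1 ^+ 2 = 1 + (primitive_disk theta l).2 ^+ 2.
Proof.
move=> th; have c0 := cos_half_gt0 th.
rewrite /= Normc.normcM Normc.normcV normc_zeta6X mul1r.
rewrite /= expr0n /= addr0 sqrtr_sqr exprVn real_normK ?num_real//.
by rewrite -cos2_tan2 ?gt_eqF// addrC; ring.
Qed.

Lemma primitive_disk_endpoint (R : realType) (theta t : R) (l : 'I_3) :
  0 < theta < 2 * pi / 3 -> t = theta / 2 \/ t = - (theta / 2) ->
  normc (zeta6 ^+ (2 * l + 1) * expi t - (primitive_disk theta l).1) =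
  (primitive_disk theta l).2.
Proof.
move=> th te; have c0 := cos_half_gt0 th.
have s0 : 0 < sin (theta / 2).
  case/andP: th => th0 th1; apply: sin_gt0_pi.
  have := pi_gt0 R; lra.
have ct : cos t = cos (theta / 2) by case: te => ->; rewrite ?cosN.
have st : sin t ^+ 2 = sin (theta / 2) ^+ 2.
  by case: te => ->; rewrite ?sinN ?sqrrN.
rewrite /= -mulrBr Normc.normcM normc_zeta6X mul1r.
have -> : (cos (theta / 2))%:C^-1 = ((cos (theta / 2))^-1)%:C.
  by rewrite fmorphV.
rewrite /expi /= subr0 st ct.
set c := cos _ in c0 *; set s := sin _ in s0 *.
have -> : (c - c^-1) ^+ 2 + s ^+ 2 = (s / c) ^+ 2.
  have cs : c ^+ 2 + s ^+ 2 = 1 by exact: cos2Dsin2.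
  have -> : (c - c^-1) ^+ 2 + s ^+ 2 = (c ^+ 2 + s ^+ 2) - 2 + (c ^+ 2)^-1.
    by field; rewrite gt_eqF.
  rewrite cs expr_div_n -[s ^+ 2](addKr (c ^+ 2)) cs.
  by field; rewrite gt_eqF.
by rewrite sqrtr_sqr ger0_norm// divr_ge0 ?ltW.
Qed.

(* Main.v *)
Require Import Defs.
From HB Require Import structures.
From mathcomp Require Import all_boot all_order all_algebra.
From mathcomp Require Import all_classical all_reals all_analysis.
From mathcomp Require Import complex ring lra zify.

Set Implicit Arguments.
Unset Strict Implicit.
Unset Printing Implicit Defensive.

Import Order.TTheory GRing.Theory Num.Theory numFieldNormedType.Exports.

Local Open Scope classical_set_scope.
Local Open Scope ring_scope.
Local Open Scope complex_scope.

(** The proof compares the limit measure mu with the discrete measure of weight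
    w_i at the sample point z_i, without Perron-Frobenius theory and without
    compactness. Let delta be the exponent of conformality of mu, and consider
    families f of functions, one on each of the three arcs that the primitive
    disks cut out of the unit circle. The transfer operator L sends f to the
    family whose value at z in the arc of D_l is the sum over s <> l of
    |rho_s'(z)|^delta f_s(rho_s z).

    The measure mu is invariant: its limit set lies in the cells of generation
    one, so that conformality under rho_s, tested on f_s times a cutoff of D_s,
    sums up to mu(L f) = mu(f) (mean_transfer).

    The discrete measure is almost invariant. Each cell P_j and each s other
    than the index of P_j determine one cell P_i in D_s with P_j contained in
    rho_s(P_i) (arrow_surj, arrow_inj), and then z_i is within 2 eps of
    rho_s(z_j). The equation T^d w = w therefore says that the discrete measure
    is invariant under L, up to a distance 2 eps in the argument of f and up to
    the replacement of delta by McMullen's exponent d (sample_mean_expand).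

    The two are compared on the cone of positive families whose logarithm is
    K-Lipschitz on each arc. The reflections contract the arcs and have bounded
    distortion, so that L maps the cone of slope K into that of slope K - 1;
    two applications of L connect all arcs, so that the values of L^2 f are
    comparable everywhere (transfer2_mixing). Hence a fixed share of the mean
    of L^2 f can be subtracted from it as a constant, and the remainder is
    again in the cone (cone_remainder). The constants have the same average for
    both measures, so that each such step multiplies their discrepancy by a
    factor less than one, and an invariance defect of size eps gives a
    discrepancy of size eps (rigidity). Iteration of L on the constant 1 also
    forces |d - delta| = O(eps), since any larger gap would make the total mass
    of the discrete measure tend to 0 or to infinity (exponent_error).

    The weighted sums of z_i^k thus converge to the integral of z^k
    (near_sample_sum). The sample points and weights have six-fold symmetry,
    and the sum of the k-th powers of the six points belonging to an angle phi
    is 2 cos(k phi) times the sum of the k-th powers of zeta_6, zeta_6^3 and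
    zeta_6^5; this last sum is 3 (-1)^(k/3) if 3 divides k, and 0 otherwise. *)

(** * The modulus *)

Section modulus.
Context {R : realType}.
Implicit Types x y z : R[i].

Lemma normc_ge0 z : 0 <= normc z.
Proof. by case: z => a b /=; rewrite sqrtr_ge0. Qed.

Lemma normc_gt0 z : (0 < normc z) = (z != 0).
Proof.
rewrite lt0r normc_ge0 andbT; congr (~~ _).
by apply/eqP/eqP => [/Normc.eq0_normc//|->]; rewrite Normc.normc0.
Qed.

Lemma normc_distC x y : normc (x - y) = normc (y - x).
Proof. by rewrite -opprB normcN. Qed.

Lemma normc_tri y x z : normc (x - z) <= normc (x - y) + normc (y - z).
Proof. by rewrite (le_trans _ (le_normcD _ _))// subrKA. Qed.

Lemma normc_sub_le x y : normc x - normc y <= normc (x - y).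
Proof. by rewrite lerBlDr (le_trans _ (le_normcD _ _))// subrK. Qed.

Lemma normc_conj z : normc (conjc z) = normc z.
Proof. by case: z => a b /=; rewrite sqrrN. Qed.

Lemma normc_real (a : R) : normc a%:C = `|a|.
Proof. by rewrite /= expr0n /= addr0 sqrtr_sqr. Qed.

Lemma normc_prod z n : normc (z ^+ n) = normc z ^+ n.
Proof.
elim: n => [|n IH]; first by rewrite !expr0 Normc.normc1.
by rewrite !exprS Normc.normcM IH.
Qed.

Lemma normc_exprz z (k : int) : normc (z ^ k) = normc z ^ k.
Proof.
case: k => n; first by rewrite -!exprnP normc_prod.
by rewrite !NegzE -!exprz_inv -!exprnP normc_prod Normc.normcV.
Qed.

Lemma normcE z : `|z| = (normc z)%:C.
Proof. by []. Qed.

Lemma Re_le_normc z : `|complex.Re z| <= normc z.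
Proof.
case: z => a b /=; rewrite -sqrtr_sqr ler_sqrt ?lerDl ?sqr_ge0//.
by rewrite addr_ge0 ?sqr_ge0.
Qed.

Lemma Im_le_normc z : `|complex.Im z| <= normc z.
Proof.
case: z => a b /=; rewrite -sqrtr_sqr ler_sqrt ?lerDr ?sqr_ge0//.
by rewrite addr_ge0 ?sqr_ge0.
Qed.

Lemma ReB x y : complex.Re (x - y) = complex.Re x - complex.Re y.
Proof. by case: x y => [a b] [c d]. Qed.

Lemma ImB x y : complex.Im (x - y) = complex.Im x - complex.Im y.
Proof. by case: x y => [a b] [c d]. Qed.

End modulus.

(** * The sixth root of unity *)

Section zeta6.
Context {R : realType}.

Lemma expiD (a b : R) : expi (a + b) = expi a * expi b.
Proof. by rewrite /expi cosD sinD; simpc; congr (_ +i* _); ring. Qed.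

Lemma expiX (a : R) n : expi a ^+ n = expi (n%:R * a).
Proof.
elim: n => [|n IH]; first by rewrite expr0 mul0r /expi cos0 sin0.
by rewrite exprS IH -expiD -natr1; congr expi; ring.
Qed.

Lemma expiN (a : R) : expi (- a) = (expi a)^-1.
Proof.
apply: (@mulfI _ (expi a)).
  by rewrite -normc_gt0 normc_expi.
rewrite -expiD subrr mulfV; first by rewrite /expi cos0 sin0.
by rewrite -normc_gt0 normc_expi.
Qed.

Lemma expi_exprz (a : R) (k : int) : expi a ^ k = expi (k%:~R * a).
Proof.
case: k => n; first by rewrite -exprnP expiX.
by rewrite NegzE -exprz_inv -expiN -exprnP expiX mulrNz mulNr mulrN.
Qed.

Lemma zeta6_cube : (zeta6 : R[i]) ^+ 3 = -1.
Proof.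
rewrite /zeta6 expiX /expi.
have -> : 3%:R * (2 * pi / 6) = pi :> R by field.
by rewrite cospi sinpi; apply/eqP; rewrite eq_complex /= oppr0 !eqxx.
Qed.

Lemma sin_third_gt0 : 0 < sin (2 * pi / 6) :> R.
Proof. by apply: sin_gt0_pi; have := pi_gt0 R; lra. Qed.

(** Read off from the imaginary part of zeta_6^3 = -1. *)
Lemma cos_third : cos (2 * pi / 6) = 1 / 2 :> R.
Proof.
have := zeta6_cube; rewrite /zeta6 /expi.
have s0 := sin_third_gt0; have cs := cos2Dsin2 (2 * pi / 6 : R).
move: s0 cs; set c := cos _; set s := sin _ => s0 cs.
rewrite !exprS expr0 mulr1 => /(congr1 (@complex.Im _)) /= E.
have {}E : s * (3 * c ^+ 2 - s ^+ 2) = 0 by rewrite -[RHS]oppr0 -E; ring.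
move: E => /eqP; rewrite mulf_eq0 gt_eqF//= => /eqP E.
have c2 : c ^+ 2 = (1 / 2) ^+ 2.
  have -> : c ^+ 2 = (c ^+ 2 + s ^+ 2 + (3 * c ^+ 2 - s ^+ 2)) / 4 by field.
  by rewrite cs E; field.
have c0 : 0 <= c.
  apply: cos_ge0_pihalf ; have := pi_gt0 R; lra.
by apply/eqP; rewrite -(@eqrXn2 _ 2)// ?c2//; lra.
Qed.

Lemma sin_third_sqr : sin (2 * pi / 6) ^+ 2 = 3 / 4 :> R.
Proof. by have := cos2Dsin2 (2 * pi / 6 : R); rewrite cos_third; lra. Qed.

End zeta6.

(** * Primitive disks and reflections *)

Section primitive_disks.
Context {R : realType} (theta : R) (htheta : 0 < theta < 2 * pi / 3).
Implicit Types (x y z : R[i]) (s l : 'I_3).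
Local Notation ctr l := (primitive_disk theta l).1.
Local Notation rad := (tan (theta / 2)).
Local Notation rho := (reflection theta).

Let cos_gt0' : 0 < cos (theta / 2).
Proof. exact: cos_half_gt0. Qed.

Let sin_gt0' : 0 < sin (theta / 2).
Proof.
by case/andP: htheta => ? ?; apply: sin_gt0_pi; have := pi_gt0 R; lra.
Qed.

Lemma rad_gt0 : 0 < rad.
Proof. by rewrite /tan divr_gt0. Qed.

Let cos_lt1 : cos (theta / 2) < 1.
Proof.
have := cos2Dsin2 (theta / 2); move: cos_gt0' sin_gt0'.
by set c := cos _; set s := sin _ => c0 s0 cs; nra.
Qed.

Lemma normc_ctr l : normc (ctr l) = (cos (theta / 2))^-1.
Proof.
rewrite /= Normc.normcM Normc.normcV normc_zeta6X mul1r.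
by rewrite -/(normc (cos (theta / 2))%:C) normc_real gtr0_norm.
Qed.

(** The distance from a primitive disk to the centre of another one. *)
Definition separation : R := Num.sqrt 3 / cos (theta / 2) - rad.

(** The angle theta / 2 is less than pi / 3: this is where the bound on theta is
    used to keep the primitive disks apart. The proof is the positivity of
    sin(3 x) = sin(x) (3 - 4 sin(x)^2). *)
Lemma sqrt3_half_sin : sin (theta / 2) < Num.sqrt 3 / 2.
Proof.
have s3 : 0 < sin (3 * (theta / 2)).
  by apply: sin_gt0_pi; case/andP: htheta => ? ?; have := pi_gt0 R; lra.
have E : sin (3 * (theta / 2)) =
    sin (theta / 2) * (3 - 4 * sin (theta / 2) ^+ 2).
  have -> : 3 * (theta / 2) = theta / 2 + theta / 2 + theta / 2 by lra.
  rewrite !(sinD, cosD).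
  have := cos2Dsin2 (theta / 2); set c := cos _; set s := sin _ => cs.
  have -> : s * (3 - 4 * s ^+ 2) = s * (3 * (c ^+ 2 + s ^+ 2) - 4 * s ^+ 2).
    by rewrite cs mulr1.
  by ring.
move: s3; rewrite E pmulr_rgt0// => s3.
have q3 : Num.sqrt 3 ^+ 2 = 3 :> R by rewrite sqr_sqrtr.
rewrite -(@ltr_pXn2r _ 2)// ?nnegrE ?divr_ge0 ?sqrtr_ge0//; last exact: ltW.
by rewrite expr_div_n q3; lra.
Qed.

Lemma rad_lt_separation : rad < separation.
Proof.
rewrite /separation /tan -mulrBl ltr_pM2r ?invr_gt0//.
by have := sqrt3_half_sin; lra.
Qed.

Lemma separation_gt0 : 0 < separation.
Proof. exact: lt_trans rad_gt0 rad_lt_separation. Qed.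

Lemma ctr_dist l s : l != s ->
  normc (ctr l - ctr s) = Num.sqrt 3 / cos (theta / 2).
Proof.
move=> ls; rewrite /= -mulrBl Normc.normcM Normc.normcV.
rewrite -/(normc (cos (theta / 2))%:C) normc_real gtr0_norm//; congr (_ / _).
have z3 := @zeta6_cube R; have c3 := @cos_third R; have s3 := @sin_third_sqr R.
have z1 : zeta6 ^+ (2 * 0 + 1) = (1 / 2) +i* sin (2 * pi / 6) :> R[i].
  by rewrite expr1 /zeta6 /expi c3.
have z2 : zeta6 ^+ (2 * 1 + 1) = (-1) +i* 0 :> R[i].
  by rewrite z3; apply/eqP; rewrite eq_complex /= oppr0 !eqxx.
have z5 : zeta6 ^+ (2 * 2 + 1) = (1 / 2) -i* sin (2 * pi / 6) :> R[i].
  rewrite -[(2 * 2 + 1)%N]/(3 + 2)%N exprD z3 expr2 /zeta6 /expi c3.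
  by simpc; congr (_ +i* _); [rewrite -expr2 s3|]; field.
have N (a b : R) : a ^+ 2 + b ^+ 2 = 3 -> normc (a +i* b) = Num.sqrt 3.
  by move=> /= ->.
case: l s ls => -[|[|[|//]]] ? [[|[|[|//]]] ?] ls;
  try by case/eqP: ls; apply: val_inj.
all: by rewrite ?z1 ?z5 ?z2; simpc; apply: N; move: s3; set b := sin _; nra.
Qed.

(** Outside D_s, at distance at least the separation from its centre, the
    reflection in D_s is a contraction; the other primitive disks lie there. *)
Lemma normc_disk_ge l s z : l != s -> normc (z - ctr l) <= rad ->
  separation <= normc (z - ctr s).
Proof.
move=> ls zl; rewrite /separation -(ctr_dist ls) lerBlDr.
rewrite (le_trans (normc_tri z _ _))// addrC lerD2l normc_distC.
exact: zl.
Qed.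

Lemma circle_ctr_ge s z : normc z = 1 ->
  (cos (theta / 2))^-1 - 1 <= normc (z - ctr s).
Proof.
by move=> z1; rewrite -(normc_ctr s) -z1 normc_distC normc_sub_le.
Qed.

Lemma circle_ctr_le s z : normc z = 1 ->
  normc (z - ctr s) <= 1 + (cos (theta / 2))^-1.
Proof.
by move=> z1; rewrite (le_trans (le_normcD z (- ctr s)))// normcN normc_ctr z1.
Qed.

Lemma circle_gap_gt0 : 0 < (cos (theta / 2))^-1 - 1.
Proof. by rewrite subr_gt0 invf_gt1. Qed.

Lemma normc_reflection s z : normc (rho s z - ctr s) = rad ^+ 2 / normc (z - ctr s).
Proof.
rewrite /reflection /inversion /= [_ + _ - _]addrC addKr.
rewrite Normc.normcM Normc.normcV normc_conj -/(normc (rad ^+ 2)%:C).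
by rewrite normc_real ger0_norm ?sqr_ge0.
Qed.

(** The distance formula for inversions, from which both the contraction and
    the distortion of the reflections follow. *)
Lemma normc_reflectionB s x y : x != ctr s -> y != ctr s ->
  normc (rho s x - rho s y) =
  rad ^+ 2 * normc (x - y) / (normc (x - ctr s) * normc (y - ctr s)).
Proof.
rewrite -(subr_eq0 x) -(subr_eq0 y) /reflection /inversion [(_, _).2]/=.
have -> : x - y = (x - ctr s) - (y - ctr s) by ring.
move: (ctr s) (x - ctr s) (y - ctr s) => c {}x {}y x0 y0.
have {}x0 : conjc x != 0 by rewrite conjc_eq0.
have {}y0 : conjc y != 0 by rewrite conjc_eq0.
have -> : c + (rad ^+ 2)%:C / conjc x - (c + (rad ^+ 2)%:C / conjc y) =
    (rad ^+ 2)%:C * conjc (y - x) / (conjc x * conjc y).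
  by rewrite rmorphB; field; rewrite x0 y0.
rewrite Normc.normcM Normc.normcV !Normc.normcM !normc_conj normc_real.
by rewrite ger0_norm ?sqr_ge0// (normc_distC y).
Qed.

(** The circle carrying D_s is orthogonal to the unit circle. *)
Lemma reflection_circle s z : normc z = 1 -> normc (rho s z) = 1.
Proof.
move=> z1; have v0 : 0 < normc (z - ctr s).
  exact: lt_le_trans circle_gap_gt0 (circle_ctr_ge s z1).
apply/eqP; rewrite -(@eqrXn2 _ 2)// ?normc_ge0// expr1n; apply/eqP.
have := primitive_disk_orthogonal s htheta; rewrite normc_sqr.
move: v0 z1; rewrite /reflection /inversion.
case: (primitive_disk theta s) => -[a b] r /=; case: z => u v /=.
rewrite sqrtr_gt0 => N0 /(congr1 (fun t => t ^+ 2)).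
rewrite !sqr_sqrtr ?addr_ge0 ?sqr_ge0// expr1n => uv ab.
have N0' : (u - a) ^+ 2 + (v - b) ^+ 2 != 0 by rewrite gt_eqF.
rewrite !(mul0r, mulr0, oppr0, addr0, sub0r, add0r, subr0) sqrrN.
have E p q : p ^+ 2 + q ^+ 2 != 0 -> (p + a) ^+ 2 + (q + b) ^+ 2 = 1 ->
    (a + r ^+ 2 * (p / (p ^+ 2 + q ^+ 2))) ^+ 2 +
    (b + r ^+ 2 * (q / (p ^+ 2 + q ^+ 2))) ^+ 2 = 1.
  move=> pq0 pq.
  have -> : (a + r ^+ 2 * (p / (p ^+ 2 + q ^+ 2))) ^+ 2 +
      (b + r ^+ 2 * (q / (p ^+ 2 + q ^+ 2))) ^+ 2 =
      a ^+ 2 + b ^+ 2 + r ^+ 2 / (p ^+ 2 + q ^+ 2) *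
      (r ^+ 2 + ((p + a) ^+ 2 + (q + b) ^+ 2) - (a ^+ 2 + b ^+ 2)
       - (p ^+ 2 + q ^+ 2)) by field.
  by rewrite pq ab; field.
rewrite -[X in _ = X](E (u - a) (v - b)) ?subrK//.
by congr (_ ^+ 2 + _ ^+ 2); field.
Qed.

(** Inversion multiplies lengths at z by rad^2 / |z - c|^2, and the curve
    z e^(it) has unit speed. *)
Lemma angular_deriv_reflection s z : normc z = 1 ->
  angular_deriv (rho s) z = rad ^+ 2 / normc (z - ctr s) ^+ 2.
Proof.
move=> z1; have v0 : 0 < normc (z - ctr s).
  exact: lt_le_trans circle_gap_gt0 (circle_ctr_ge s z1).
have r0 := rad_gt0; rewrite normc_sqr.
have E2 : rad = (primitive_disk theta s).2 by [].
move: v0 z1 r0; rewrite /angular_deriv /reflection /inversion /expi E2.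
case: (primitive_disk theta s) => -[a b] r; case: z => u v.
move=> v0 /(congr1 (fun t => t ^+ 2)); move: v0 => /=.
rewrite sqrtr_gt0 => N0 .
rewrite !sqr_sqrtr ?addr_ge0 ?sqr_ge0// expr1n => uv r0.
pose x (t : R) := u * cos t - v * sin t - a.
pose y (t : R) := u * sin t + v * cos t - b.
have dx : is_derive (0 : R) 1 x (- v).
  apply: is_derive_eq; rewrite !(scaler0, scale0r, addr0, add0r, subr0).
  by rewrite cos0 sin0 oppr0 scaler0 add0r -scaleNr /GRing.scale/= mulr1.
have dy : is_derive (0 : R) 1 y u.
  apply: is_derive_eq; rewrite !(scaler0, scale0r, addr0, add0r, subr0).
  by rewrite cos0 sin0 oppr0 scaler0 addr0 /GRing.scale/= mulr1.
have x0 : x 0 = u - a by rewrite /x cos0 sin0; ring.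
have y0 : y 0 = v - b by rewrite /y cos0 sin0; ring.
pose N := fun t => (x t * x t + y t * y t).
have N0' : N 0 != 0 by rewrite /N x0 y0 -!expr2 gt_eqF.
have dN : is_derive (0 : R) 1 N (2 * (- (u - a) * v + (v - b) * u)).
  apply: is_derive_eq; rewrite x0 y0 /GRing.scale/=; ring.
have dV : is_derive (0 : R) 1 (fun t => (N t)^-1)
    (- (N 0) ^- 2 * (2 * (- (u - a) * v + (v - b) * u))).
  apply: DeriveDef; first exact: derivableV.
  by rewrite deriveV// derive_val.
rewrite !derive1E.
have N00 : N 0 = (u - a) ^+ 2 + (v - b) ^+ 2 by rewrite /N x0 y0 !expr2.
rewrite (_ : 'D_(1 : R) _ (0 : R) = r ^+ 2 * (x 0 * (- (N 0) ^- 2 *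
    (2 * (- (u - a) * v + (v - b) * u))) + (N 0)^-1 * - v)); last first.
  rewrite (_ : (fun _ => _) = fun t => a + r ^+ 2 * (x t * (N t)^-1)); last first.
    by apply/funext => t; rewrite mul0r subr0 sqrrN /N !expr2.
  by apply: derive_val; apply: is_derive_eq; rewrite add0r /GRing.scale /=; ring.
rewrite (_ : 'D_(1 : R) _ (0 : R) = r ^+ 2 * (y 0 * (- (N 0) ^- 2 *
    (2 * (- (u - a) * v + (v - b) * u))) + (N 0)^-1 * u)); last first.
  rewrite (_ : (fun _ => _) = fun t => b + r ^+ 2 * (y t * (N t)^-1)); last first.
    by apply/funext => t; rewrite mul0r addr0 mulNr opprK sqrrN /N !expr2.
  by apply: derive_val; apply: is_derive_eq; rewrite add0r /GRing.scale /=; ring.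
have r2 : 0 <= r ^+ 2 / N 0 by rewrite divr_ge0 ?sqr_ge0// N00 ltW.
rewrite -N00 -[RHS]ger0_norm// -sqrtr_sqr; congr Num.sqrt.
rewrite x0 y0.
have E : (u - a) ^+ 2 + (v - b) ^+ 2 != 0 by rewrite -N00.
have -> : (r ^+ 2 / N 0) ^+ 2 = (r ^+ 2) ^+ 2 * (u ^+ 2 + v ^+ 2) / N 0 ^+ 2.
  by rewrite uv mulr1 expr_div_n.
by rewrite N00; field.
Qed.

End primitive_disks.

(** * Words *)

Section words.

Definition reduced (w : seq 'I_3) := sorted (fun s t => s != t) w.

Lemma reduced_cons2 s t w : reduced [:: s, t & w] = (s != t) && reduced (t :: w).
Proof. by []. Qed.

Lemma reduced_cons s w : reduced (s :: w) -> reduced w.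
Proof. by case: w => //= t w /andP[]. Qed.

Lemma reduced_prefix u v : prefix u v -> reduced v -> reduced u.
Proof.
move=> /prefixP[w ->]; elim: u => [|s [|t u] IH]//.
by rewrite !cat_cons !reduced_cons2 => /andP[-> /IH].
Qed.

Lemma other_letter (s t : 'I_3) : exists x, (x != s) && (x != t).
Proof.
case: s t => -[|[|[|//]]] ? [[|[|[|//]]] ?];
  by [exists (inord 0); rewrite -!val_eqE /= !inordK
     |exists (inord 1); rewrite -!val_eqE /= !inordK
     |exists (inord 2); rewrite -!val_eqE /= !inordK].
Qed.

(** Every word can be continued indefinitely, because each letter has two
    successors. *)
Lemma reduced_extend n w : reduced w ->
  exists2 v, reduced v & prefix w v && (n <= size v)%N.
Proof.
elim: n => [|n IH] rw; first by exists w; rewrite // prefix_refl.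
have [v rv /andP[wv nv]] := IH rw.
have [x /andP[xl _]] := other_letter (last ord0 v) (last ord0 v).
exists (rcons v x); last first.
  by rewrite (prefix_trans wv (prefix_rcons _ _)) size_rcons.
case: v rv xl {wv nv} => [|s v] //= rv xl; rewrite /reduced /=.
by rewrite rcons_path rv /= eq_sym.
Qed.

Fixpoint words n : seq (seq 'I_3) :=
  if n is k.+1 then
    [seq s :: w | s <- enum 'I_3, w <- [seq w <- words k | head ord0 w != s]]
  else [seq [:: s] | s <- enum 'I_3].

(** The words of length n + 1 index the cells of generation n. *)
Lemma mem_words n w : (w \in words n) = reduced w && (size w == n.+1).
Proof.
elim: n w => [|n IH] w /=.
  apply/mapP/andP => [[s _ ->]//|[]].
  by case: w => [|s []]// _ _; exists s; rewrite ?mem_enum.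
apply/allpairsPdep/idP => [[s [v [_ + ->]]]|/andP[rw sw]].
  rewrite mem_filter IH => /and3P[vs rv /eqP sv].
  by case: v vs rv sv => // t v vs rv [sv]; rewrite reduced_cons2 eq_sym vs rv/= sv.
case: w rw sw => // s [|t w]// rw sw; exists s, (t :: w).
rewrite mem_enum mem_filter IH; split=> //.
move: rw; rewrite reduced_cons2 eq_sym => /andP[-> ->] /=.
by move: sw; rewrite eqSS.
Qed.

Lemma words_uniq n : uniq (words n).
Proof.
elim: n => [|n IH] /=.
  by rewrite map_inj_uniq ?enum_uniq// => s t [].
apply: allpairs_uniq_dep; [exact: enum_uniq|by move=> s _; exact: filter_uniq|].
by move=> [s u] [t v] _ _ /= [-> ->].
Qed.

Definition diverge (u v : seq 'I_3) := ~~ prefix u v && ~~ prefix v u.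

Lemma prefix_comparable (u v w : seq 'I_3) : prefix u w -> prefix v w ->
  prefix u v || prefix v u.
Proof.
elim: w u v => [|s w IH] [|a u] [|b v]//=.
by move=> /andP[/eqP-> uw] /andP[/eqP-> vw]; rewrite eqxx /=; exact: IH.
Qed.

Lemma diverge_extend u v u' v' : diverge u v -> prefix u u' -> prefix v v' ->
  diverge u' v'.
Proof.
move=> + uu vv; rewrite /diverge -!negb_or; apply: contra => /orP[]h.
  exact: prefix_comparable (prefix_trans uu h) vv.
exact: prefix_comparable uu (prefix_trans vv h).
Qed.

Lemma diverge_words n u v : u \in words n -> v \in words n -> u != v ->
  diverge u v.
Proof.
rewrite !mem_words => /andP[_ /eqP su] /andP[_ /eqP sv] uv.
by rewrite /diverge !prefixE su -sv take_size sv -su take_size [v == u]eq_sym uv.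
Qed.

End words.

(** * Cells *)

Section cells.
Context {R : realType} (theta : R) (htheta : 0 < theta < 2 * pi / 3).
Implicit Types (z : R[i]) (s t l : 'I_3) (u v w : seq 'I_3).
Local Notation pd := (primitive_disk theta).
Local Notation rad := (tan (theta / 2)).
Local Notation rho := (reflection theta).
Local Notation sep := (separation theta).

(** The cell rho_(s_0) ... rho_(s_(n-1)) (D_(s_n)) of the word s_0 ... s_n. Only
    nonempty words index cells, and (0, 1) is a dummy value. *)
Fixpoint cell (w : seq 'I_3) : disk R :=
  match w with
  | [::] => (0, 1)
  | s :: w' => if w' is [::] then pd s else reflect_disk (pd s) (cell w')
  end.

Let rad0 : 0 < rad. Proof. exact: rad_gt0. Qed.
Let rad_sep : rad < sep. Proof. exact: rad_lt_separation. Qed.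
Let sep0 : 0 < sep. Proof. exact: separation_gt0. Qed.

Lemma inner_radius_lt : rad ^+ 2 / sep < rad.
Proof. by rewrite ltr_pdivrMr// expr2 ltr_pM2l. Qed.

Lemma primitive_disjoint s t z :
  closed_disk (pd s) z -> closed_disk (pd t) z -> s = t.
Proof.
move=> zs zt; apply/eqP; apply: contraT => st.
have := normc_disk_ge htheta st zs; rewrite leNgt.
by rewrite (le_lt_trans zt).
Qed.

Lemma Re_homothety (k : R) (c a : R[i]) : complex.Re (c + k%:C * (a - c)) =
  complex.Re c + k * (complex.Re a - complex.Re c).
Proof. by move: c a => [c1 c2] [a1 a2] /=; rewrite mul0r subr0. Qed.

Lemma Im_homothety (k : R) (c a : R[i]) : complex.Im (c + k%:C * (a - c)) =
  complex.Im c + k * (complex.Im a - complex.Im c).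
Proof. by move: c a => [c1 c2] [a1 a2] /=; rewrite mul0r addr0. Qed.

(** The inductive step for cells: a disk in D_t orthogonal to the unit circle is
    reflected in another D_s to a smaller orthogonal disk, well inside D_s. *)
Lemma reflect_disk_geometry s t (E : disk R) : s != t -> 0 < E.2 ->
    normc E.1 ^+ 2 = 1 + E.2 ^+ 2 ->
    normc (E.1 - (pd t).1) + E.2 <= rad ->
  let F := reflect_disk (pd s) E in
  [/\ E.2 < normc (E.1 - (pd s).1), 0 < F.2 < E.2,
      normc F.1 ^+ 2 = 1 + F.2 ^+ 2 &
      normc (F.1 - (pd s).1) + F.2 <= rad ^+ 2 / sep].
Proof.
move=> st; case: E => a e; rewrite [(a, e).1]/= [(a, e).2]/= => e0 ae at1.
have dd : normc ((pd t).1 - (pd s).1) = sep + rad.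
  by rewrite ctr_dist 1?eq_sym// /separation subrK.
have cc := primitive_disk_orthogonal s htheta.
have ds : sep + e <= normc (a - (pd s).1).
  have := normc_tri a (pd t).1 (pd s).1; rewrite dd normc_distC; lra.
rewrite /reflect_disk [(a, e).1]/= [(a, e).2]/=.
move: cc ds; rewrite -/(pd s); have -> : (pd s).2 = rad by [].
move: rad0 rad_sep sep0.
set c := (pd s).1; set r := rad; set q := sep; set v := normc (a - c).
move=> r0 rq q0 cc ds.
have N0 : 0 < v ^+ 2 - e ^+ 2 by rewrite subr_gt0 ltr_pXn2r// ?nnegrE; lra.
set k := r ^+ 2 / (v ^+ 2 - e ^+ 2).
have k0 : 0 < k by rewrite divr_gt0// exprn_gt0.
have kE : k * (v ^+ 2 - e ^+ 2) = r ^+ 2 by rewrite /k divfK// gt_eqF.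
have k1 : k < 1.
  rewrite ltr_pdivrMr// mul1r subr_sqr.
  rewrite expr2 (lt_le_trans (_ : _ < q * q))//; first by nra.
  by nra.
split.
- lra.
- by rewrite mulr_gt0//= gtr_pMl.
- have vE := normc_sqr (a - c); have cE := normc_sqr c.
  rewrite /= exprMn.
  rewrite normc_sqr.
  have aE := normc_sqr a.
  move: aE cE vE kE cc ae; rewrite -/v => aE cE vE kE; rewrite aE cE => cc ae.
  have -> : complex.Re (c + k%:C * (a - c)) =
     complex.Re c + k * (complex.Re a - complex.Re c).
    by rewrite Re_homothety.
  have -> : complex.Im (c + k%:C * (a - c)) =
     complex.Im c + k * (complex.Im a - complex.Im c).
    by rewrite Im_homothety.
  move: vE; rewrite ReB ImB; move: cc ae.
  set x := complex.Re c; set y := complex.Im c.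
  set x' := complex.Re a; set y' := complex.Im a => cc ae vE.
  have -> : (x + k * (x' - x)) ^+ 2 + (y + k * (y' - y)) ^+ 2 =
     (x ^+ 2 + y ^+ 2) + k * ((x' ^+ 2 + y' ^+ 2) - (x ^+ 2 + y ^+ 2)
        - ((x' - x) ^+ 2 + (y' - y) ^+ 2))
     + k * (k * ((x' - x) ^+ 2 + (y' - y) ^+ 2)) by ring.
  rewrite -vE cc ae.
  have kv : k * v ^+ 2 = r ^+ 2 + k * e ^+ 2 by rewrite -kE; ring.
  rewrite kv; have -> : k * (1 + e ^+ 2 - (1 + r ^+ 2) - v ^+ 2) =
    k * e ^+ 2 - k * r ^+ 2 - k * v ^+ 2 by ring.
  by rewrite kv; ring.
- rewrite /= [_ + _ - c]addrC addKr Normc.normcM normc_real gtr0_norm// -/v.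
  rewrite -mulrDr /k subr_sqr.
  have -> : r ^+ 2 / ((v - e) * (v + e)) * (v + e) = r ^+ 2 / (v - e).
    by field; apply/andP; split; rewrite gt_eqF//; lra.
  by rewrite ler_pM2l ?exprn_gt0// lef_pV2 ?posrE; lra.
Qed.

Lemma cell_geometry s w : reduced (s :: w) ->
  [/\ 0 < (cell (s :: w)).2,
      normc (cell (s :: w)).1 ^+ 2 = 1 + (cell (s :: w)).2 ^+ 2 &
      normc ((cell (s :: w)).1 - (pd s).1) + (cell (s :: w)).2 <= rad].
Proof.
elim: w s => [|t w IH] s.
  by move=> _; rewrite /cell primitive_disk_orthogonal// subrr Normc.normc0 add0r.
rewrite reduced_cons2 => /andP[st /IH[e0 ce ct]].
have [_ /andP[F0 _] F1 F2] := reflect_disk_geometry st e0 ce ct.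
by split=> //; apply: le_trans F2 _; exact/ltW/inner_radius_lt.
Qed.

Lemma cell_reflect s t w : reduced [:: s, t & w] ->
  (cell (t :: w)).2 < normc ((cell (t :: w)).1 - (pd s).1) /\
  (cell [:: s, t & w]).2 < (cell (t :: w)).2.
Proof.
rewrite reduced_cons2 => /andP[st rw].
have [e0 ce ct] := cell_geometry rw.
by have [? /andP[_ ?] _ _] := reflect_disk_geometry st e0 ce ct.
Qed.

Lemma reflectionK s : involutive (rho s).
Proof. exact: inversionK. Qed.

Lemma cell_reflection_mem s t w z : reduced [:: s, t & w] ->
  closed_disk (cell [:: s, t & w]) (rho s z) <-> closed_disk (cell (t :: w)) z.
Proof.
move=> rw; apply: inversion_closed_disk_mem => //.
have [+ _] := cell_reflect rw; move/reduced_cons : rw => /cell_geometry[e0 _ _].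
by move=> ->; rewrite ltW.
Qed.

Lemma reflection_cell s t w : reduced [:: s, t & w] ->
  rho s @` closed_disk (cell [:: s, t & w]) = closed_disk (cell (t :: w)).
Proof.
move=> rw; apply/seteqP; split => [_ [z + <-]|z zw].
  by rewrite -{1}[z](reflectionK s) => /(cell_reflection_mem _ rw).
by exists (rho s z); [exact/cell_reflection_mem|exact: reflectionK].
Qed.

Lemma cell_sub_head s w z : reduced (s :: w) ->
  closed_disk (cell (s :: w)) z -> closed_disk (pd s) z.
Proof.
move=> /cell_geometry[_ _ ct] zw.
rewrite /closed_disk /=; apply: le_trans ct.
by rewrite (le_trans (normc_tri (cell (s :: w)).1 _ _))// addrC lerD2l.
Qed.

Lemma cell_center_mem s w : reduced (s :: w) ->
  closed_disk (cell (s :: w)) (cell (s :: w)).1.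
Proof.
by move=> /cell_geometry[/ltW e0 _ _]; rewrite /closed_disk/= subrr Normc.normc0.
Qed.

(** Longer words have smaller cells: both cells are the image under the
    reflections of the common prefix of a cell contained in a primitive disk. *)
Lemma cell_prefix u v : reduced v -> u != [::] -> prefix u v ->
  closed_disk (cell v) `<=` closed_disk (cell u).
Proof.
elim: u v => // s [|t u] IH [|s' [|t' v]]//.
- by move=> _ _ /=; rewrite andbT => /eqP->.
- by rewrite prefix_cons => rv _ /andP[/eqP-> _] z; exact: cell_sub_head.
- by rewrite prefix_cons andbF.
rewrite !prefix_cons => rv _ /and3P[/eqP ss /eqP tt uv] z; rewrite ss.
rewrite -{1}[z](reflectionK s') => /(cell_reflection_mem _ rv) zv.
rewrite -[z](reflectionK s'); apply/cell_reflection_mem.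
  move: rv; rewrite tt => /reduced_prefix; apply.
  by rewrite !prefix_cons !eqxx.
by apply: (IH (t' :: v)) => //; [exact: reduced_cons rv|rewrite prefix_cons tt eqxx].
Qed.

(** Two cells that meet are nested: a common prefix is undone by reflections,
    and different first letters give disjoint primitive disks. *)
Lemma cell_meet u v z : u != [::] -> v != [::] -> reduced u -> reduced v ->
  closed_disk (cell u) z -> closed_disk (cell v) z -> prefix u v || prefix v u.
Proof.
elim: u v z => // s [|t u] IH [|s' v] z// _ _ ru rv zu zv.
  by rewrite prefix_cons (primitive_disjoint zu (cell_sub_head rv zv)) eqxx prefix0s.
have ss := primitive_disjoint (cell_sub_head ru zu) (cell_sub_head rv zv).
move: v rv zv; rewrite -{s'}ss => -[|t' v] rv zv; first by rewrite !prefix_cons eqxx prefix0s orbT.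
rewrite [prefix (s :: _) _]prefix_cons [X in _ || X]prefix_cons eqxx !andTb.
apply: (IH _ (rho s z)) => //; try exact: reduced_cons ru;
  try exact: reduced_cons rv.
- by apply/(cell_reflection_mem _ ru); rewrite reflectionK.
- by apply/(cell_reflection_mem _ rv); rewrite reflectionK.
Qed.

Lemma diverge_disjoint u v z : u != [::] -> v != [::] ->
  reduced u -> reduced v -> diverge u v ->
  closed_disk (cell u) z -> closed_disk (cell v) z -> False.
Proof.
move=> u0 v0 ru rv /andP[/negPf uv /negPf vu] zu zv.
by have := cell_meet u0 v0 ru rv zu zv; rewrite uv vu.
Qed.

Lemma sub_disk_primitive s t w : reduced (t :: w) ->
  sub_disk (cell (t :: w)) (pd s) = (t == s).
Proof.
move=> rw; apply/asboolP/eqP => [tw|<-]; last by move=> z; exact: cell_sub_head.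
have zw := cell_center_mem rw.
exact: primitive_disjoint (cell_sub_head rw zw) (tw _ zw).
Qed.

Lemma primitive_index_cell s w : reduced (s :: w) ->
  primitive_index theta (cell (s :: w)) = s.
Proof.
move=> rw; rewrite /primitive_index; case: pickP => [t|/(_ s)].
  by rewrite sub_disk_primitive// => /eqP.
by rewrite sub_disk_primitive// eqxx.
Qed.

Lemma generationE n : generation theta n = map cell (words n).
Proof.
elim: n => [|n IH]; first by rewrite /= -map_comp.
rewrite [words n.+1]/= map_allpairs [LHS]/= IH.
congr flatten; apply/eq_in_map => s _.
rewrite filter_map -!map_comp.
have -> : [seq w <- words n | preim cell (fun P => ~~ sub_disk P (pd s)) w] =
    [seq w <- words n | head ord0 w != s].
  apply: eq_in_filter => w; rewrite mem_words => /andP[rw /eqP].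
  by case: w rw => // t w rw _ /=; rewrite sub_disk_primitive.
apply/eq_in_map => w; rewrite mem_filter mem_words => /and3P[_ _ /eqP].
by case: w.
Qed.

(** The children of a cell are the cells of the one-letter extensions of its
    word, as cells of different words of equal length are disjoint. *)
Lemma childrenE w : w != [::] -> reduced w ->
  children theta (size w).-1 (cell w) =
  map cell [seq v <- words (size w) | prefix w v].
Proof.
move=> w0 rw; have sw : (size w).-1.+1 = size w by case: w w0 {rw}.
rewrite /children sw generationE filter_map; congr map.
apply: eq_in_filter => v; rewrite mem_words => /andP[rv /eqP sv] /=.
apply/asboolP/idP => [vw|wv]; last by move: (cell_prefix rv w0 wv).
have v0 : v != [::] by case: v sv {rv vw}.
have zv : closed_disk (cell v) (cell v).1.
  by case: v rv {sv vw} v0 => // s v rv _; exact: cell_center_mem.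
case/orP: (cell_meet w0 v0 rw rv (vw _ zv) zv) => //.
by move=> /size_prefix; rewrite sv ltnn.
Qed.

(** Orthogonality gives |a|^2 = 1 + r^2 for the centre a, so that the radial
    projection of a is at distance |a| - 1 <= r from it. *)
Lemma radial_proj_cell s w : reduced (s :: w) ->
  normc (radial_proj (cell (s :: w)).1) = 1 /\
  closed_disk (cell (s :: w)) (radial_proj (cell (s :: w)).1).
Proof.
move=> /cell_geometry[]; case: (cell _) => a e /= e0 ae _.
have a1 : 1 < normc a.
  rewrite -(@ltr_pXn2r _ 2)// ?nnegrE ?normc_ge0// ae expr1n ltrDl exprn_gt0//.
have a0 : 0 < normc a by lra.
rewrite /radial_proj; split.
  by rewrite Normc.normcM Normc.normcV normc_real gtr0_norm// mulfV// gt_eqF.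
rewrite /closed_disk /=.
have -> : a / (normc a)%:C - a = a * ((normc a)^-1 - 1)%:C.
  by rewrite rmorphB/= fmorphV mulrBr mulr1.
rewrite Normc.normcM normc_real -{1}(gtr0_norm a0) -normrM mulrBr mulr1.
rewrite mulfV ?gt_eqF// distrC gtr0_norm ?subr_gt0//.
rewrite -(@ler_pXn2r _ 2)// ?nnegrE; lra.
Qed.

End cells.

(** * The final list as an antichain of words *)

Section final_list.
Context {R : realType} (theta : R) (htheta : 0 < theta < 2 * pi / 3) (eps : R).
Implicit Types (z : R[i]) (s t l : 'I_3) (u v w : seq 'I_3) (W : seq (seq 'I_3)).
Local Notation cell := (cell theta).

Let tag w : nat * disk R := ((size w).-1, cell w).

Definition refine_words W : seq (seq 'I_3) :=
  flatten [seq if (cell w).2 < eps then [:: w]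
               else [seq v <- words (size w) | prefix w v] | w <- W].

Definition stage k := iter k refine_words (words 1).

Lemma mem_refine_words W v : v \in refine_words W ->
  exists2 w : seq 'I_3, w \in W &
    (v = w /\ (cell w).2 < eps) \/
    [/\ eps <= (cell w).2, reduced v, size v = (size w).+1 & prefix w v].
Proof.
move=> /flatten_mapP[w wW]; case: ltP => we.
  by rewrite inE => /eqP->; exists w => //; left.
rewrite mem_filter mem_words => /and3P[wv rv /eqP sv].
by exists w => //; right.
Qed.

Lemma stage_mem k w : w \in stage k ->
  [/\ reduced w, (2 <= size w <= k.+2)%N &
      forall u, prefix u w -> (2 <= size u < size w)%N -> eps <= (cell u).2].
Proof.
elim: k w => [|k IH] w.
  rewrite -[stage 0]/(words 1) mem_words => /andP[rw /eqP sw].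
  by rewrite sw; split => // u _; lia.
rewrite /stage iterS => /mem_refine_words[v /IH[rv sv pv]].
case=> [[-> _]|[ev rw sw vw]].
  by split => //; move: sv => /andP[-> /leqW].
split => //; first by rewrite sw ltnS; case/andP: sv => s2 sk; rewrite ltnS sk (ltnW s2).
move=> u uw su; case: (ltngtP (size u) (size v)) => suv.
- apply: pv; last lia.
  case/orP: (prefix_comparable uw vw) => // /size_prefix.
  by rewrite leqNgt suv.
- lia.
- case/orP: (prefix_comparable uw vw) => h.
    by move: h; rewrite prefixE suv take_size => /eqP <-.
  by move: h; rewrite prefixE -suv take_size => /eqP ->.
Qed.

Lemma refine_words_diverge W : pairwise diverge W ->
  pairwise diverge (refine_words W).
Proof.
have ch w v : v \in (if (cell w).2 < eps then [:: w]
    else [seq v <- words (size w) | prefix w v]) -> prefix w v.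
  case: ifP => _; last by rewrite mem_filter => /andP[].
  by rewrite inE => /eqP->; exact: prefix_refl.
elim: W => // w W IH; rewrite pairwise_cons => /andP[/allP wW /IH pW].
rewrite /refine_words /= pairwise_cat pW andbT; apply/andP; split.
  apply/allrelP => v v' vw /flatten_mapP[w' w'W v'w'].
  exact: diverge_extend (wW _ w'W) (ch _ _ vw) (ch _ _ v'w').
case: ifP => // _; have := filter_uniq (fun v => prefix w v) (words_uniq (size w)).
have : {subset [seq v <- words (size w) | prefix w v] <= words (size w)}.
  by move=> v; rewrite mem_filter => /andP[].
elim: [seq _ <- _ | _] => // v s IHs vs /= /andP[vs' us]; apply/andP; split.
  apply/allP => v' v's; apply: (diverge_words (n := size w)).
  - by apply: vs; rewrite mem_head.
  - by apply: vs; rewrite inE v's orbT.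
  - by apply: contraNneq vs' => ->.
by apply: IHs => // v' v's; apply: vs; rewrite inE v's orbT.
Qed.

Lemma stage_diverge k : pairwise diverge (stage k).
Proof.
elim: k => [|k IH]; last exact: refine_words_diverge.
rewrite -[stage 0]/(words 1); have := words_uniq 1.
have : {subset words 1 <= words 1} by [].
elim: {1 3 4}(words 1) => // v s IHs vs /= /andP[vs' us]; apply/andP; split.
  apply/allP => v' v's; apply: (diverge_words (n := 1)).
  - by apply: vs; rewrite mem_head.
  - by apply: vs; rewrite inE v's orbT.
  - by apply: contraNneq vs' => ->.
by apply: IHs => // v' v's; apply: vs; rewrite inE v's orbT.
Qed.

(** No branch of the tree of words is lost during the refinement. *)
Lemma stage_cover k v : reduced v -> (k.+2 <= size v)%N ->
  exists2 w : seq 'I_3, w \in stage k & prefix w v.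
Proof.
move=> rv; elim: k => [|k IH] sv.
  exists (take 2 v); last exact: prefix_take.
  rewrite -[stage 0]/(words 1) mem_words size_takel// eqxx andbT.
  exact: reduced_prefix (prefix_take _ _) rv.
have [w wk wv] := IH (ltnW sv).
have [rw /andP[_ sw] _] := stage_mem wk.
have [we|we] := ltP (cell w).2 eps.
  exists w => //; rewrite /stage iterS; apply/flatten_mapP; exists w => //.
  by rewrite we inE.
exists (take (size w).+1 v); last exact: prefix_take.
rewrite /stage iterS; apply/flatten_mapP; exists w => //.
rewrite ltNge we /= mem_filter mem_words size_takel ?eqxx ?andbT; last first.
  exact: leq_trans sv.
apply/andP; split; last exact: reduced_prefix (prefix_take _ _) rv.
by rewrite prefixE take_takel // -prefixE.
Qed.

Lemma iter_refine k :
  iter k (refine theta eps) [seq (1%N, Q) | Q <- generation theta 1] =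
  map tag (stage k).
Proof.
elim: k => [|k IH].
  rewrite -[stage 0]/(words 1) [LHS]/= -/(generation theta 1) generationE// -map_comp; apply/eq_in_map => w.
  by rewrite mem_words /tag => /andP[_ /eqP ->].
rewrite iterS IH /stage iterS -/(stage k) /refine /refine_words map_flatten.
rewrite -!map_comp; congr flatten; apply/eq_in_map => w /stage_mem[rw /andP[sw _] _] /=.
have w0 : w != [::] by case: w sw {rw}.
case: ifP => // _; rewrite childrenE// -map_comp; apply/eq_in_map => v.
rewrite mem_filter mem_words /tag => /and3P[_ _ /eqP sv] /=.
by rewrite sv; case: w w0 sw {rw sv}.
Qed.

(** What the algorithm guarantees about the words of the final list: they are
    the first ones on each branch, beyond the first letter, whose cells are
    small; the last clause says that they meet every sufficiently long branch. *)
Definition stopping W : Prop :=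
  [/\ forall w, w \in W -> [/\ reduced w, (2 <= size w)%N, (cell w).2 < eps &
        forall u, prefix u w -> (2 <= size u < size w)%N -> eps <= (cell u).2],
      pairwise diverge W &
      exists n, forall v, reduced v -> (n <= size v)%N ->
        exists2 w : seq 'I_3, w \in W & prefix w v].

Lemma final_listP (P : seq (disk R)) : is_final_list theta eps P ->
  exists2 W, P = map cell W & stopping W.
Proof.
move=> [k]; rewrite iter_refine => -[/allP small ->].
exists (stage k); first by rewrite -map_comp.
split; [|exact: stage_diverge|by exists k.+2; exact: stage_cover].
move=> w wk; have [rw /andP[sw _] pw] := stage_mem wk; split => //.
by apply: (small (tag w)); apply: map_f.
Qed.

(** The Markov property of the final list: rho_s maps the cell of some word
    s u of the list to a cell that contains the cell of w. Here s u is the word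
    of the list on a branch through s w. It cannot be longer than s w, because
    the cell of s w is already smaller than that of w. *)
Lemma stopping_preimage W s w : stopping W -> w \in W -> s != head ord0 w ->
  exists u, [/\ s :: u \in W, u != [::], reduced (s :: u) & prefix u w].
Proof.
move=> [mW _ [n cW]] wW sw; have [rw s2 we _] := mW w wW.
have rsw : reduced (s :: w).
  by case: w sw rw {wW s2 we} => // t w sw rw; rewrite reduced_cons2 sw.
have [v rv /andP[wv nv]] := reduced_extend n rsw.
have [x xW xv] := cW v rv nv; have [rx sx _ px] := mW x xW.
(* x, the word of the list, and s w are prefixes of the same branch v. *)
case/orP: (prefix_comparable wv xv) => [wx|xw]; last first.
  case: x xw xW rx sx {xv px} => // t u; rewrite prefix_cons.
  move=> /andP[/eqP-> uw] tuW rtu su; exists u; split => //.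
  by case: u su {uw tuW rtu}.
have [sz|sz] := leqP (size x) (size w).+1.
  have xE : x = s :: w.
    by move: wx; rewrite prefixE /= take_oversize// => /eqP.
  exists w; split; rewrite -?xE// ?prefix_refl//.
  by case: w s2 {wW sw rw we rsw wv wx sz xE}.
have := px _ wx; rewrite /= sz ltnS (leq_trans _ s2)// => /(_ isT) le.
case: w rw s2 we rsw le {wW sw wv wx sz} => // t w rw _ we rsw.
have [_ lt] := cell_reflect htheta rsw.
by rewrite leNgt (lt_trans lt we).
Qed.

End final_list.

(** * Topology and Borel sets of the plane *)

Section plane_topology.
Context {R : realType}.
Implicit Types (x y z : R[i]) (A : set R[i]).

Lemma gt0C_real (e : R[i]) : 0 < e -> exists2 r : R, 0 < r & e = r%:C.
Proof.
case: e => a b; rewrite ltcE /= => /andP[/eqP-> a0].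
by exists a.
Qed.

(** The radii of balls in the complex plane are complex numbers; this gives
    neighbourhoods with real radii. *)
Lemma nbhs_normcP z A : nbhs z A <->
  exists2 e : R, 0 < e & forall x, normc (z - x) < e -> A x.
Proof.
split => [/nbhs_ballP[e /= e0 zA]|[e e0 zA]].
  have [r r0 er] := gt0C_real e0; exists r => // x zx; apply: zA.
  by rewrite -ball_normE /= er normcE ltcR.
apply/nbhs_ballP; exists e%:C => /=; first by rewrite ltcR.
by move=> x; rewrite -ball_normE /= normcE ltcR; exact: zA.
Qed.

Lemma open_normc_gt z (r : R) : open [set x | r < normc (x - z)].
Proof.
rewrite openE => x /= rx; apply/nbhs_normcP.
exists (normc (x - z) - r); first by rewrite subr_gt0.
by move=> y xy /=; have := normc_tri y x z; lra.
Qed.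

Lemma closed_normc_le z (r : R) : closed [set x | normc (x - z) <= r].
Proof.
rewrite (_ : [set x | _] = ~` [set x | r < normc (x - z)]); last first.
  by apply/seteqP; split => x /=; rewrite leNgt => /negP.
exact/open_closedC/open_normc_gt.
Qed.

Lemma closed_unit_circle : closed (@unit_circle R).
Proof.
rewrite (_ : unit_circle =
    [set x | normc (x - 0) <= 1] `&` ~` [set x | normc x < 1]).
  apply: closedI; first exact: closed_normc_le.
  apply: open_closedC; rewrite openE => x /= x1; apply/nbhs_normcP.
  exists (1 - normc x); first by rewrite subr_gt0.
  move=> y xy /=; have := normc_sub_le y x; rewrite normc_distC in xy; lra.
apply/seteqP; split => x; rewrite /unit_circle /= subr0.
  by move=> ->; rewrite ltxx lexx; split.
by move=> [x1 /negP]; rewrite -leNgt => x1'; apply/eqP; rewrite eq_le x1.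
Qed.

Lemma closed_measurableC A : closed A -> measurable (A : set (borelC R)).
Proof.
move=> /closed_openC oA; rewrite -[A]setCK; apply: measurableC.
exact: sub_sigma_algebra.
Qed.

End plane_topology.

(** * Functions that are bounded and Lipschitz on the circle *)

Section bounded_lipschitz.
Context {R : realType}.
Implicit Types (x y z : R[i]) (u v : R[i] -> R).
Local Notation S1 := (@unit_circle R).

Definition bounded_lipschitz u := exists B : R, [/\ 0 <= B, forall x, S1 x -> `|u x| <= B &
  forall x y, S1 x -> S1 y -> `|u x - u y| <= B * normc (x - y)].

Lemma bl_intro u (B1 B2 : R) : (forall x, S1 x -> `|u x| <= B1) ->
  (forall x y, S1 x -> S1 y -> `|u x - u y| <= B2 * normc (x - y)) -> bounded_lipschitz u.
Proof.
move=> b1 b2; exists (`|B1| + `|B2|); split=> [|x x1|x y x1 y1].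
- by rewrite addr_ge0.
- by rewrite (le_trans (b1 x x1))// (le_trans (ler_norm _))// lerDl.
rewrite (le_trans (b2 _ _ x1 y1))// ler_wpM2r ?normc_ge0//.
by rewrite (le_trans (ler_norm _))// lerDr.
Qed.

Lemma bl_cst (a : R) : bounded_lipschitz (fun=> a).
Proof.
apply: (@bl_intro _ `|a| 0) => // x y _ _.
by rewrite subrr normr0 mul0r.
Qed.

Lemma blD u v : bounded_lipschitz u -> bounded_lipschitz v -> bounded_lipschitz (fun z => u z + v z).
Proof.
move=> [B [B0 uB uL]] [C [C0 vC vL]]; apply: (@bl_intro _ (B + C) (B + C)).
  by move=> x x1; rewrite (le_trans (ler_normD _ _))// lerD ?uB ?vC.
move=> x y x1 y1; rewrite opprD addrACA (le_trans (ler_normD _ _))// mulrDl.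
by rewrite lerD ?uL ?vL.
Qed.

Lemma blM u v : bounded_lipschitz u -> bounded_lipschitz v -> bounded_lipschitz (fun z => u z * v z).
Proof.
move=> [B [B0 uB uL]] [C [C0 vC vL]].
apply: (@bl_intro _ (B * C) (B * C + C * B)).
  by move=> x x1; rewrite normrM ler_pM ?uB ?vC.
move=> x y x1 y1.
have -> : u x * v x - u y * v y = u x * (v x - v y) + v y * (u x - u y) by ring.
rewrite (le_trans (ler_normD _ _))// mulrDl -!mulrA lerD// normrM.
  by rewrite ler_pM ?uB ?vL.
by rewrite ler_pM ?vC ?uL.
Qed.

Lemma bl_comp u (g : R[i] -> R[i]) (B : R) : (forall x, S1 x -> S1 (g x)) ->
  (forall x y, S1 x -> S1 y -> normc (g x - g y) <= B * normc (x - y)) ->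
  bounded_lipschitz u -> bounded_lipschitz (fun z => u (g z)).
Proof.
move=> gS gL [C [C0 uC uL]]; apply: (@bl_intro _ C (C * B)).
  by move=> x x1; rewrite uC//; exact: gS.
move=> x y x1 y1; rewrite (le_trans (uL _ _ (gS _ x1) (gS _ y1)))// -mulrA.
by rewrite ler_wpM2l// gL.
Qed.

Lemma eq_bl u v : u =1 v -> bounded_lipschitz u -> bounded_lipschitz v.
Proof. by move=> /funext ->. Qed.

Lemma bl_sum (I : Type) (r : seq I) (P : pred I) (F : I -> R[i] -> R) :
  (forall i, P i -> bounded_lipschitz (F i)) -> bounded_lipschitz (fun z => \sum_(i <- r | P i) F i z).
Proof.
move=> blF; elim: r => [|i r IH].
  by apply: eq_bl (bl_cst 0) => z; rewrite big_nil.
have [Pi|Pi] := boolP (P i).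
  by apply: eq_bl (blD (blF i Pi) IH) => z; rewrite big_cons Pi.
by apply: eq_bl IH => z; rewrite big_cons (negPf Pi).
Qed.

Lemma bl_continuous u : bounded_lipschitz u ->
  {within unit_circle, continuous (fun z => (u z)%:C)}.
Proof.
move=> [B [B0 _ uL]]; apply/subspace_continuousP => x x1.
apply/cvgrPdist_lt => _ /gt0C_real[e e0 ->].
apply/nbhs_normcP; exists (e / (B + 1)); first by rewrite divr_gt0// ltr_wpDl.
move=> y; rewrite ltr_pdivlMr ?ltr_wpDl// => xy y1.
rewrite normcE -rmorphB normc_real ltcR (le_lt_trans (uL _ _ x1 y1))//.
rewrite (le_lt_trans _ xy)// mulrC ler_wpM2l ?normc_ge0//; lra.
Qed.

Lemma measurable_unit_circle : measurable (unit_circle : set (borelC R)).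
Proof. exact: closed_measurableC closed_unit_circle. Qed.

(** The points where a Lipschitz function exceeds a are cut out of the circle by
    an open set, a union of balls of radius proportional to the excess. *)
Lemma bl_measurable u : bounded_lipschitz u ->
  measurable_fun (unit_circle : set (borelC R)) (u : borelC R -> R).
Proof.
move=> [B [B0 _ uL]].
move=> mS; apply: (measurability _ (measurable_realfun.RGenOInfty.measurableE R)) => // _ [_ [a ->] <-].
have B1 : 0 < B + 1 by rewrite ltr_wpDl.
(* The union of the balls in which the Lipschitz bound keeps u above a. *)
pose O := [set z : R[i] | exists x, [/\ S1 x, a < u x &
  normc (x - z) < (u x - a) / (B + 1)]].
rewrite (_ : _ `&` _ = unit_circle `&` O).
  apply: measurableI => //.
  apply: sub_sigma_algebra; rewrite /= openE => z [x [x1 xa xz]].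
  apply/nbhs_normcP; exists ((u x - a) / (B + 1) - normc (x - z)).
    by rewrite subr_gt0.
  by move=> y zy; exists x; split=> //; have := normc_tri z x y; lra.
apply/seteqP; split => z [z1] /=.
  rewrite in_itv/= andbT => az; split=> //; exists z; split=> //.
  by rewrite subrr Normc.normc0 divr_gt0// subr_gt0.
move=> [x [x1 xa]]; rewrite ltr_pdivlMr// => xz; split=> //.
rewrite in_itv/= andbT; have := uL _ _ x1 z1; rewrite ler_norml => /andP[_].
have := normc_ge0 (x - z); nra.
Qed.

Lemma bl_integrable (mu : probability (borelC R) R) u : bounded_lipschitz u ->
  mu.-integrable unit_circle (EFin \o u).
Proof.
move=> ublip; apply: measurable_bounded_integrable.
- exact: measurable_unit_circle.
- by rewrite (le_lt_trans (probability_le1 _ _)) ?ltry//; exact: measurable_unit_circle.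
- exact: bl_measurable.
move: ublip => [B [B0 uB _]]; exists B; split; first exact: num_real.
by move=> M BM x x1 /=; rewrite (le_trans (uB x x1))// ltW.
Qed.

End bounded_lipschitz.

(** * Dilation and distortion *)

Section real_lemmas.
Context {R : realType}.

Lemma expR_sub1_le (h : R) : expR h - 1 <= h * expR h.
Proof.
have := @expR_ge1Dx R (- h); rewrite expRN => H.
have e0 := expR_gt0 h.
have : (1 - h) * expR h <= (expR h)^-1 * expR h by rewrite ler_pM2r.
rewrite mulVf ?gt_eqF//; lra.
Qed.

Lemma clamp_dist (a b : R) :
  `|Num.max 0 (Num.min 1 a) - Num.max 0 (Num.min 1 b)| <= `|a - b|.
Proof.
have E (c : R) : [\/ c <= 0 /\ Num.max 0 (Num.min 1 c) = 0,
    0 <= c <= 1 /\ Num.max 0 (Num.min 1 c) = c |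
    1 <= c /\ Num.max 0 (Num.min 1 c) = 1].
  have [c0|c0] := leP c 0.
    by apply: Or31; rewrite min_r ?max_l//; lra.
  have [c1|c1] := leP c 1; first by apply: Or32; rewrite max_r ?ltW ?c0.
  by apply: Or33; rewrite max_r//; split=> //; exact: ltW.
case: (ger0P (a - b)) => ab; rewrite ler_norml;
  by case: (E a) => -[? ->]; case: (E b) => -[? ->]; lra.
Qed.

(** On a set of diameter 2, control of the logarithm gives control of the
    function itself. *)
Lemma bl_of_log_lipschitz (u : R[i] -> R) (a : R) : 0 <= a ->
  (forall x, unit_circle x -> 0 < u x) ->
  (forall x y, unit_circle x -> unit_circle y ->
    u x <= expR (a * normc (x - y)) * u y) -> bounded_lipschitz u.
Proof.
move=> a0 u0 ul.
have d2 x y : unit_circle x -> unit_circle y -> normc (x - y) <= 2 :> R.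
  by move=> x1 y1; rewrite (le_trans (le_normcD _ _))// normcN x1 y1.
have c1 : unit_circle (1 : R[i]) by exact: Normc.normc1.
pose C := expR (a * 2) * u 1.
have uC x : unit_circle x -> u x <= C.
  move=> x1; rewrite (le_trans (ul x 1 x1 c1))// ler_wpM2r ?(ltW (u0 _ c1))//.
  by rewrite ler_expR ler_wpM2l// d2.
apply: (@bl_intro _ _ C (a * expR (a * 2) * C)).
  by move=> x x1; rewrite gtr0_norm ?u0// uC.
have lip x y : unit_circle x -> unit_circle y ->
    u x - u y <= a * expR (a * 2) * C * normc (x - y).
  move=> x1 y1; have h0 : 0 <= a * normc (x - y) by rewrite mulr_ge0 ?normc_ge0.
  rewrite (@le_trans _ _ ((expR (a * normc (x - y)) - 1) * u y))//.
    by rewrite mulrBl mul1r lerD2r ul.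
  rewrite (_ : _ * C * _ = (a * normc (x - y) * expR (a * 2)) * C); last by ring.
  rewrite ler_pM//.
  - by rewrite subr_ge0 -expR0 ler_expR.
  - exact/ltW/u0.
  - rewrite (le_trans (expR_sub1_le _))// ler_wpM2l// ler_expR ler_wpM2l//.
    exact: d2.
  - exact: uC.
move=> x y x1 y1; rewrite ler_norml lip// andbT lerNl opprB normc_distC.
exact: lip.
Qed.

End real_lemmas.

Section dilation.
Context {R : realType} (theta : R) (htheta : 0 < theta < 2 * pi / 3).
Implicit Types (x y z : R[i]) (s t l : 'I_3).
Local Notation pd := (primitive_disk theta).
Local Notation rad := (tan (theta / 2)).
Local Notation rho := (reflection theta).
Local Notation sep := (separation theta).

(** The derivative of the reflection in D_s along the unit circle, see
    angular_deriv_reflection. *)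
Definition dilation s z : R := rad ^+ 2 / normc (z - (pd s).1) ^+ 2.

(** The distance from the unit circle to the centres of the primitive disks. *)
Definition circle_gap : R := (cos (theta / 2))^-1 - 1.

Let gap0 : 0 < circle_gap. Proof. exact: circle_gap_gt0. Qed.
Let rad0 : 0 < rad. Proof. exact: rad_gt0. Qed.
Let sep0 : 0 < sep. Proof. exact: separation_gt0. Qed.

Lemma ctr_gt0 s z : unit_circle z -> 0 < normc (z - (pd s).1).
Proof. by move=> z1; exact: lt_le_trans gap0 (circle_ctr_ge htheta s z1). Qed.

Lemma neq_ctr s z : unit_circle z -> z != (pd s).1.
Proof. by move=> /(ctr_gt0 s); rewrite normc_gt0 subr_eq0. Qed.

Lemma dilation_gt0 s z : unit_circle z -> 0 < dilation s z.
Proof. by move=> /(ctr_gt0 s) c0; rewrite divr_gt0 ?exprn_gt0. Qed.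

Lemma ln_ctr_dist s x y : unit_circle x -> unit_circle y ->
  ln (normc (x - (pd s).1)) - ln (normc (y - (pd s).1)) <=
  normc (x - y) / circle_gap.
Proof.
move=> x1 y1; have p0 := ctr_gt0 s x1; have q0 := ctr_gt0 s y1.
have := circle_ctr_ge htheta s y1; rewrite -/circle_gap => gy.
have := normc_tri y x (pd s).1; move: p0 q0 gy.
set p := normc (x - _); set q := normc (y - _); set t := normc (x - y).
move=> p0 q0 gy pt; have t0 : 0 <= t by exact: normc_ge0.
rewrite lerBlDl -[X in _ + X]expRK -lnM ?posrE ?expR_gt0//.
rewrite ler_ln ?posrE ?mulr_gt0 ?expR_gt0//.
apply: (@le_trans _ _ (q * (1 + t / circle_gap))); last first.
  by rewrite ler_wpM2l ?(ltW q0)// expR_ge1Dx.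
have : t <= q * (t / circle_gap).
  by rewrite mulrCA ler_peMr// ler_pdivlMr// mul1r.
by rewrite mulrDr mulr1; lra.
Qed.

Lemma dilation_powR s z (d : R) : unit_circle z ->
  dilation s z `^ d = expR (d * (2 * (ln rad - ln (normc (z - (pd s).1))))).
Proof.
move=> z1; have p0 := ctr_gt0 s z1; have g0 := dilation_gt0 s z1.
rewrite /powR gt_eqF//; congr (expR (_ * _)).
rewrite /dilation -expr_div_n lnXn; last by rewrite divr_gt0.
have -> : ln (rad / normc (z - (pd s).1)) = ln rad - ln (normc (z - (pd s).1)).
  exact: ln_div.
by rewrite mulr_natl.
Qed.

(** Bounded distortion: |z - c_s| is bounded from below on the circle, so that
    its logarithm is Lipschitz. *)
Lemma dilation_distortion s x y (d : R) : unit_circle x -> unit_circle y ->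
  dilation s x `^ d <=
  expR (`|d| * (2 / circle_gap) * normc (x - y)) * dilation s y `^ d.
Proof.
move=> x1 y1; rewrite !dilation_powR// -expRD ler_expR -lerBlDr -mulrBr.
rewrite (le_trans (ler_norm _))// normrM -mulrA ler_wpM2l//.
rewrite -mulrBr normrM ger0_norm// -[2 / _ * _]mulrA ler_wpM2l//.
rewrite [_^-1 * _]mulrC.
have := ln_ctr_dist s x1 y1; have := ln_ctr_dist s y1 x1.
rewrite (normc_distC y x) ler_norml; lra.
Qed.

Lemma bl_dilation s (d : R) : bounded_lipschitz (fun z => dilation s z `^ d).
Proof.
apply: bl_of_log_lipschitz (fun x y => @dilation_distortion s x y d).
  by rewrite mulr_ge0// divr_ge0 ?ltW.
by move=> x x1; rewrite powR_gt0 ?dilation_gt0.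
Qed.

Lemma bl_reflection s u : bounded_lipschitz u -> bounded_lipschitz (fun z => u (rho s z)).
Proof.
apply: (bl_comp (B := rad ^+ 2 / circle_gap ^+ 2)).
  by move=> x; exact: reflection_circle.
move=> x y x1 y1; rewrite normc_reflectionB ?neq_ctr// -mulrA -mulrA.
rewrite ler_wpM2l ?sqr_ge0// mulrC ler_wpM2r ?normc_ge0//.
have := circle_ctr_ge htheta s x1; have := circle_ctr_ge htheta s y1.
rewrite -/circle_gap => gy gx.
rewrite lef_pV2 ?posrE ?exprn_gt0 ?mulr_gt0 ?ctr_gt0//.
by rewrite expr2 ler_pM// ltW.
Qed.

End dilation.

(** * The limit set and the limit measure *)

Section limit_set.
Context {R : realType} (theta : R) (htheta : 0 < theta < 2 * pi / 3).
Implicit Types (x y z : R[i]) (s t l : 'I_3).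
Local Notation pd := (primitive_disk theta).
Local Notation rad := (tan (theta / 2)).
Local Notation rho := (reflection theta).
Local Notation sep := (separation theta).

Let rad0 : 0 < rad. Proof. exact: rad_gt0. Qed.
Let sep0 : 0 < sep. Proof. exact: separation_gt0. Qed.

(** The cells of generation one in D_s lie in the concentric disk of this
    radius, see reflection_inner. *)
Definition inner_radius : R := rad ^+ 2 / sep.

Definition inner_arcs : set R[i] :=
  unit_circle `&` \bigcup_s [set z | normc (z - (pd s).1) <= inner_radius].

(** Cancellation of two equal adjacent reflections. *)
Lemma group_word_reduced w z : exists2 v, reduced v &
  group_word theta v z = group_word theta w z.
Proof.
elim: w => [|s w [v rv vw]]; first by exists [::].
case: v rv vw => [|t v] rv vw; first by exists [:: s] => //=; rewrite -vw.
have [st|st] := eqVneq s t; last first.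
  by exists [:: s, t & v]; [rewrite reduced_cons2 st|rewrite /= -vw].
exists v; first exact: reduced_cons rv.
by rewrite /= -vw st /= reflectionK.
Qed.

Lemma normc_reflection0 s : normc (rho s 0) = cos (theta / 2).
Proof.
have c0 := cos_half_gt0 htheta.
have := primitive_disk_orthogonal s htheta; have := normc_ctr htheta s.
rewrite /reflection /inversion; case: (pd s) => c r /= nc cr.
have nc0 : 0 < normc c by rewrite nc invr_gt0.
have cc0 : conjc c != 0 by rewrite conjc_eq0 -normc_gt0.
have E : (c + (r ^+ 2)%:C / conjc (0 - c)) * conjc c = 1.
  have {}cr : c * conjc c = 1 + (r ^+ 2)%:C.
    by rewrite -sqr_normc normcE -rmorphXn/= cr rmorphD.
  rewrite sub0r rmorphN/= invrN mulrN mulrBl divfK// cr addrK//.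
have := congr1 (@Normc.normc R) E.
rewrite Normc.normcM normc_conj Normc.normc1 nc => /(canRL (mulfK _)) ->.
  by rewrite mul1r invrK.
by rewrite invr_eq0 gt_eqF.
Qed.

Lemma reflection_inner s t z : s != t -> normc (z - (pd t).1) <= rad ->
  normc (rho s z - (pd s).1) <= inner_radius.
Proof.
move=> st zt; have := normc_disk_ge htheta (_ : t != s) zt.
rewrite eq_sym => /(_ st) sz; rewrite normc_reflection ler_wpM2l ?sqr_ge0//.
by rewrite lef_pV2 ?posrE// (lt_le_trans sep0).
Qed.

Lemma orbit0 s w : reduced (s :: w) ->
  normc (group_word theta (s :: w) 0 - (pd s).1) <=
    if w is [::] then rad else inner_radius.
Proof.
elim: w s => [|t w IH] s.
  move=> _; rewrite normc_reflection sub0r normcN normc_ctr// invrK.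
  rewrite expr2 -mulrA ger_pMr// /tan divfK; last first.
    by rewrite gt_eqF// cos_half_gt0.
  exact: sin_le1.
rewrite reduced_cons2 => /andP[st /IH tw].
apply: (reflection_inner st); case: w tw {IH} => //= x w /le_trans; apply.
exact/ltW/(inner_radius_lt htheta).
Qed.

Lemma closed_inner_disks :
  closed (\bigcup_s [set z : R[i] | normc (z - (pd s).1) <= inner_radius]).
Proof.
by apply: closed_bigcup => [|s _]; [exact: finite_finset|exact: closed_normc_le].
Qed.

(** The orbit of 0 consists of 0, of the three points rho_s(0), which also lie
    inside the unit disk, and of points of the three inner disks, whose union
    is closed. *)
Lemma limit_set_inner : limit_set theta 0 `<=` inner_arcs.
Proof.
move=> z [zG z1]; split => //.
pose F := [set z : R[i] | normc (z - 0) <= cos (theta / 2)] `|`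
  \bigcup_s [set z : R[i] | normc (z - (pd s).1) <= inner_radius].
have cF : closed F.
  by apply: closedU; [exact: closed_normc_le|exact: closed_inner_disks].
have : F z.
  rewrite (_ : F = closure F); last exact/closure_id.
  move: z zG {z1}; apply: closureS => _ [_ [w _ <-] <-].
  have [v rv <-] := group_word_reduced w 0.
  case: v rv => [_|s [|t v] rv].
  - left; change (is_true (normc (0 - 0 : R[i]) <= cos (theta / 2))).
    by rewrite subrr Normc.normc0 ltW// cos_half_gt0.
  - by left; rewrite /= subr0 normc_reflection0.
  - by right; exists s => //; exact: (orbit0 rv).
case=> // /=; rewrite subr0 z1 leNgt => /negP[].
by have := circle_gap_gt0 htheta; rewrite subr_gt0 invf_gt1// cos_half_gt0.
Qed.

Lemma measurable_inner_arcs : measurable (inner_arcs : set (borelC R)).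
Proof.
apply: closed_measurableC; apply: closedI; last exact: closed_inner_disks.
exact: closed_unit_circle.
Qed.

Lemma measurable_limit_set p :
  measurable (limit_set theta p : set (borelC R)).
Proof.
apply: closed_measurableC; apply: closedI; last exact: closed_unit_circle.
exact: closed_closure.
Qed.

End limit_set.

Section limit_measure.
Context {R : realType} (theta : R) (htheta : 0 < theta < 2 * pi / 3).
Context (mu : probability (borelC R) R).
Hypothesis mu_limit : forall p, unit_disk p -> mu (~` limit_set theta p) = 0%E.
Implicit Types (x y z : R[i]) (s t l : 'I_3) (u v : R[i] -> R).
Implicit Types (f g : 'I_3 -> R[i] -> R).
Local Notation pd := (primitive_disk theta).
Local Notation rad := (tan (theta / 2)).
Local Notation rho := (reflection theta).
Local Notation sep := (separation theta).
Local Notation inner := (inner_radius theta).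
Local Notation Lam := (inner_arcs theta).

Let rad0 : 0 < rad. Proof. exact: rad_gt0. Qed.
Let sep0 : 0 < sep. Proof. exact: separation_gt0. Qed.
Let inner_lt : inner < rad. Proof. exact: inner_radius_lt. Qed.

Lemma mu_inner_arcsC : mu (~` Lam) = 0%E.
Proof.
apply/eqP; rewrite eq_le measure_ge0 andbT.
have p0 : unit_disk (0 : R[i]).
  by change (is_true (normc (0 : R[i]) < 1)); rewrite Normc.normc0.
rewrite -(mu_limit p0).
apply: le_measure; rewrite ?inE.
- by apply: measurableC; exact: measurable_inner_arcs.
- by apply: measurableC; exact: measurable_limit_set.
- by apply: subsetC; exact: limit_set_inner.
Qed.

Lemma mu_inner_arcs : mu Lam = 1%E.
Proof.
have mL := measurable_inner_arcs theta.
rewrite -[Lam]setCK probability_setC ?mu_inner_arcsC ?sube0//.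
exact: measurableC.
Qed.

Definition mean u : R := \int[mu]_(z in Lam) u z.

Lemma bl_integrable_inner u : bounded_lipschitz u -> mu.-integrable Lam (EFin \o u).
Proof.
move=> /(bl_integrable mu) iu; apply: integrableS iu.
- exact: measurable_unit_circle.
- exact: measurable_inner_arcs.
- by move=> z [].
Qed.

Lemma mean_circle u : bounded_lipschitz u -> \int[mu]_(z in unit_circle) u z = mean u.
Proof.
move=> blu; rewrite /mean /Rintegral.
rewrite (@negligible_integral _ _ _ mu unit_circle (~` Lam)).
- by congr (fine (integral _ _ _)); rewrite setDE setCK; apply/seteqP; split=> z [] // ? [].
- by apply: measurableC; exact: measurable_inner_arcs.
- exact: measurable_unit_circle.
- exact: bl_integrable.
- exact: mu_inner_arcsC.
Qed.

Lemma mean_cst (a : R) : mean (fun=> a) = a.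
Proof.
rewrite /mean Rintegral_cst; last exact: measurable_inner_arcs.
have E : fine (mu Lam) = 1 by rewrite mu_inner_arcs.
by rewrite [X in _ * X]E mulr1.
Qed.

Lemma meanD u v : bounded_lipschitz u -> bounded_lipschitz v -> mean (fun z => u z + v z) = mean u + mean v.
Proof.
move=> blu blv; apply: RintegralD; first exact: measurable_inner_arcs.
  exact: bl_integrable_inner.
exact: bl_integrable_inner.
Qed.

Lemma le_mean u v : bounded_lipschitz u -> bounded_lipschitz v -> (forall z, Lam z -> u z <= v z) ->
  mean u <= mean v.
Proof.
move=> blu blv uv; apply: le_Rintegral => //; first exact: measurable_inner_arcs.
  exact: bl_integrable_inner.
exact: bl_integrable_inner.
Qed.

Lemma eq_mean u v : (forall z, Lam z -> u z = v z) -> mean u = mean v.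
Proof. by move=> uv; apply: eq_Rintegral => z; rewrite inE => /uv. Qed.

Lemma mean_sum (F : 'I_3 -> R[i] -> R) : (forall s, bounded_lipschitz (F s)) ->
  mean (fun z => \sum_s F s z) = \sum_s mean (F s).
Proof.
move=> blF; elim: (index_enum _) => [|s r IH].
  rewrite big_nil -[RHS](mean_cst 0).
  by apply: eq_mean => z _; rewrite big_nil.
rewrite big_cons -IH -meanD//; last exact: bl_sum.
by apply: eq_mean => z _; rewrite big_cons.
Qed.

Lemma cintegral_real u : bounded_lipschitz u ->
  complex.Re (cintegral mu unit_circle (fun z => (u z)%:C)) = mean u.
Proof. exact: mean_circle. Qed.

Section conformal.
Variable delta : R.
Hypothesis conformal : forall (g : R[i] -> R[i]) (f : R[i] -> R[i]),
  Gamma theta g -> {within unit_circle, continuous f} ->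
  cintegral mu unit_circle f = cintegral mu unit_circle
    (fun z => f (g z) * (angular_deriv g z `^ delta)%:C).

(** Conformality, for a single reflection and a real test function. *)
Lemma mean_reflection s u : bounded_lipschitz u ->
  mean u = mean (fun z => dilation theta s z `^ delta * u (rho s z)).
Proof.
move=> blu; have G : Gamma theta (rho s) by exists [:: s].
rewrite -cintegral_real// (conformal G (bl_continuous blu)).
rewrite -cintegral_real; last first.
  by apply: blM; [exact: bl_dilation|exact: bl_reflection].
rewrite /cintegral /=; apply: eq_Rintegral => z; rewrite inE => z1 /=.
by rewrite mulr0 subr0 angular_deriv_reflection// mulrC.
Qed.

(** A Lipschitz substitute for the indicator function of D_s, to which
    conformality does not apply: it is 1 on the inner disk and 0 outside D_s,
    so that it agrees with the indicator on the limit set. *)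
Definition cutoff s z : R :=
  Num.max 0 (Num.min 1 ((rad - normc (z - (pd s).1)) / (rad - inner))).

Lemma cutoff1 s z : normc (z - (pd s).1) <= inner -> cutoff s z = 1.
Proof.
move=> zs; rewrite /cutoff min_l ?max_r//.
by rewrite ler_pdivlMr ?mul1r ?subr_gt0// lerD2l lerN2.
Qed.

Lemma cutoff0 s z : rad <= normc (z - (pd s).1) -> cutoff s z = 0.
Proof.
move=> zs; have c0 : (rad - normc (z - (pd s).1)) / (rad - inner) <= 0.
  by rewrite ler_pdivrMr ?subr_gt0// mul0r subr_le0.
by rewrite /cutoff max_l// ge_min c0 orbT.
Qed.

Lemma bl_cutoff s : bounded_lipschitz (cutoff s).
Proof.
apply: (@bl_intro _ _ 1 (rad - inner)^-1) => [z _|x y _ _].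
  rewrite ger0_norm /cutoff ?le_max ?lexx//.
  by rewrite ge_max ler01 ge_min lexx.
rewrite (le_trans (clamp_dist _ _))// -mulrBl normrM mulrC.
have i0 : 0 < (rad - inner)^-1 by rewrite invr_gt0 subr_gt0.
rewrite gtr0_norm// ler_wpM2l ?(ltW i0)//.
rewrite opprB addrC addrA subrK ler_norml; have := normc_tri y x (pd s).1.
by have := normc_tri x y (pd s).1; rewrite (normc_distC y x); lra.
Qed.

(** Integrals of a family of functions, one for each arc, are integrals of the
    function glued from it with the cutoffs; on the limit set it is f l on the
    arc of D_l, see glueE. *)
Definition glue f z : R := \sum_s cutoff s z * f s z.

Definition arc l : set R[i] := unit_circle `&` closed_disk (pd l).

Lemma bl_glue f : (forall s, bounded_lipschitz (f s)) -> bounded_lipschitz (glue f).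
Proof. by move=> blf; apply: bl_sum => s _; apply: blM; [exact: bl_cutoff|]. Qed.

Lemma cutoff_inner l z s : normc (z - (pd l).1) <= inner ->
  cutoff s z = (s == l)%:R.
Proof.
move=> zl; have [->|sl] := eqVneq s l; first exact: cutoff1.
apply: cutoff0; rewrite eq_sym in sl.
apply: le_trans (normc_disk_ge htheta sl _); first exact/ltW/rad_lt_separation.
exact: le_trans zl (ltW inner_lt).
Qed.

Lemma glueE l z f : normc (z - (pd l).1) <= inner -> glue f z = f l z.
Proof.
move=> zl; rewrite /glue (bigD1 l)//= (cutoff_inner _ zl) eqxx mul1r big1 ?addr0//.
by move=> s /negPf sl; rewrite (cutoff_inner _ zl) sl mul0r.
Qed.

Definition transfer f l z : R :=
  \sum_(s | s != l) dilation theta s z `^ delta * f s (rho s z).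

Lemma bl_transfer f l : (forall s, bounded_lipschitz (f s)) -> bounded_lipschitz (transfer f l).
Proof.
move=> blf; apply: bl_sum => s _; apply: blM; first exact: bl_dilation.
exact: bl_reflection.
Qed.

Lemma inner_reflection_out l z : unit_circle z -> normc (z - (pd l).1) <= inner ->
  rad <= normc (rho l z - (pd l).1).
Proof.
move=> z1 zl; rewrite normc_reflection ler_pdivlMr ?ctr_gt0//.
rewrite (le_trans (ler_wpM2l (ltW rad0) zl))// expr2 ler_wpM2l ?ltW//.
Qed.

(** Summing conformality over the three reflections: on the limit set, the
    cutoff of D_s composed with rho_s is the indicator of the complement of
    D_s, since rho_s exchanges the inner disk of D_s with the outside of a
    larger disk and maps the other primitive disks to the inner disk. *)
Lemma mean_transfer f : (forall s, bounded_lipschitz (f s)) ->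
  mean (glue (transfer f)) = mean (glue f).
Proof.
move=> blf; have blcf s : bounded_lipschitz (fun z => cutoff s z * f s z).
  by apply: blM => //; exact: bl_cutoff.
rewrite [RHS](mean_sum blcf).
under eq_bigr => s _ do rewrite (mean_reflection s (blcf s)).
rewrite -mean_sum; last first.
  by move=> s; apply: blM; [exact: bl_dilation|exact: (bl_reflection htheta s (blcf s))].
apply: eq_mean => z [z1 [l _ /= zl]]; rewrite (glueE _ zl) /transfer.
rewrite [RHS](bigD1 l)//= cutoff0 ?inner_reflection_out// mul0r mulr0 add0r.
apply: eq_bigr => s sl; rewrite cutoff1 ?mul1r//.
by apply: (reflection_inner htheta sl); exact: le_trans zl (ltW inner_lt).
Qed.

Lemma le_mean_glue f g : (forall s, bounded_lipschitz (f s)) -> (forall s, bounded_lipschitz (g s)) ->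
  (forall l z, arc l z -> f l z <= g l z) -> mean (glue f) <= mean (glue g).
Proof.
move=> blf blg fg; apply: le_mean; try exact: bl_glue.
move=> z [z1 [l _ /= zl]]; rewrite !(glueE _ zl); apply: fg; split => //.
exact: le_trans zl (ltW inner_lt).
Qed.

Lemma mean_glue_cst (a : R) : mean (glue (fun _ _ => a)) = a.
Proof.
rewrite -[RHS](mean_cst a); apply: eq_mean => z [z1 [l _ /= zl]].
by rewrite (glueE _ zl).
Qed.

Lemma mean_glueD f (a : R) : (forall s, bounded_lipschitz (f s)) ->
  mean (glue (fun s z => f s z + a)) = mean (glue f) + a.
Proof.
move=> blf; rewrite -[X in _ = _ + X](mean_cst a) -meanD; try exact: bl_cst.
- by apply: eq_mean => z [z1 [l _ /= zl]]; rewrite !(glueE _ zl).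
- exact: bl_glue.
Qed.

Lemma mean_glue_circle u : bounded_lipschitz u -> mean (glue (fun=> u)) =
  \int[mu]_(z in unit_circle) u z.
Proof.
move=> blu; rewrite mean_circle//; apply: eq_mean => z [z1 [l _ /= zl]].
by rewrite (glueE _ zl).
Qed.

End conformal.

End limit_measure.

(** * The cone of log-Lipschitz functions *)

Section geometric_bounds.
Context {R : realType}.

Lemma le0_geometric (k c C : R) : 0 <= k < 1 -> (forall n, c <= k ^+ n * C) -> c <= 0.
Proof.
move=> /andP[k0 k1] H.
have : (fun n => k ^+ n * C) @ \oo --> 0 * C.
  by apply: cvgMl; apply: cvg_expr; rewrite ger0_norm.
rewrite mul0r => cv; rewrite -(cvg_lim _ cv)//.
apply: limr_ge; first by apply/cvg_ex; exists 0.
by near=> n; exact: H.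
Unshelve. all: by end_near. Qed.

(** From any arc, the words of two further letters reach each of the three arcs
    once or twice. *)
Lemma sum_two_steps (b : 'I_3 -> R) l l' : (forall t, 0 <= b t) ->
  \sum_(s | s != l) \sum_(t | t != s) b t <=
  2 * \sum_(s | s != l') \sum_(t | t != s) b t.
Proof.
move=> b0; have b00 := b0 ord0.
have b01 := b0 (lift ord0 ord0); have b02 := b0 (lift ord0 (lift ord0 ord0)).
rewrite ![\sum_(s | s != _) _]big_mkcond /= !big_ord_recl !big_ord0.
rewrite ![\sum_(s | s != _) _]big_mkcond /= !big_ord_recl !big_ord0 /=.
by case: l l' => -[|[|[|//]]] ? [[|[|[|//]]] ?]; rewrite /eq_op /=; lra.
Qed.

End geometric_bounds.

Section cone.
Context {R : realType} (theta : R) (htheta : 0 < theta < 2 * pi / 3).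
Variable delta : R.
Implicit Types (x y z : R[i]) (s t l : 'I_3) (u v : R[i] -> R).
Implicit Types (f g : 'I_3 -> R[i] -> R).
Local Notation pd := (primitive_disk theta).
Local Notation rad := (tan (theta / 2)).
Local Notation rho := (reflection theta).
Local Notation sep := (separation theta).
Local Notation arc := (arc theta).
Local Notation L := (transfer theta delta).
Local Notation gap := (circle_gap theta).

Let rad0 : 0 < rad. Proof. exact: rad_gt0. Qed.
Let sep0 : 0 < sep. Proof. exact: separation_gt0. Qed.
Let gap0 : 0 < gap. Proof. exact: circle_gap_gt0. Qed.

Lemma arc_circle l z : arc l z -> unit_circle z.
Proof. by case. Qed.

Lemma arc_dist l l' x y : arc l x -> arc l' y -> normc (x - y) <= 2.
Proof.
by move=> [x1 _] [y1 _]; rewrite (le_trans (le_normcD _ _))// normcN x1 y1.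
Qed.

(** A bound for the dilation of a reflection on the other two arcs, and hence
    its Lipschitz constant there. *)
Definition contraction : R := rad ^+ 2 / sep ^+ 2.

Lemma contraction_gt0 : 0 < contraction.
Proof. by rewrite divr_gt0 ?exprn_gt0. Qed.

Lemma contraction_lt1 : contraction < 1.
Proof.
rewrite ltr_pdivrMr ?exprn_gt0// mul1r ltr_pXn2r// ?nnegrE ?ltW//.
exact: rad_lt_separation.
Qed.

Lemma arc_reflection l s z : s != l -> arc l z -> arc s (rho s z).
Proof.
move=> sl [z1 zl]; split; first exact: reflection_circle.
rewrite /closed_disk /=; apply: le_trans (reflection_inner htheta sl zl) _.
exact/ltW/inner_radius_lt.
Qed.

Lemma arc_contraction l s x y : s != l -> arc l x -> arc l y ->
  normc (rho s x - rho s y) <= contraction * normc (x - y).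
Proof.
rewrite eq_sym => sl [x1 xl] [y1 yl]; rewrite normc_reflectionB ?neq_ctr//.
rewrite mulrAC ler_wpM2r ?normc_ge0// ler_wpM2l ?sqr_ge0//.
have sx := normc_disk_ge htheta sl xl; have sy := normc_disk_ge htheta sl yl.
by rewrite lef_pV2 ?posrE ?exprn_gt0 ?mulr_gt0 ?ctr_gt0// expr2 ler_pM// ltW.
Qed.

Definition log_dilation_bound : R :=
  2 * (`|ln rad| + `|ln gap| + `|ln (1 + (cos (theta / 2))^-1)|).

Lemma ln_dilation s z : unit_circle z -> ln (dilation theta s z) =
  2 * (ln rad - ln (normc (z - (pd s).1))).
Proof.
move=> z1; have := dilation_powR htheta s 1 z1; rewrite powRr1; last first.
  exact/ltW/dilation_gt0.
by move=> ->; rewrite mul1r expRK.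
Qed.

Lemma ln_dilation_le s z : unit_circle z ->
  `|ln (dilation theta s z)| <= log_dilation_bound.
Proof.
move=> z1; rewrite ln_dilation// /log_dilation_bound normrM ger0_norm// ler_wpM2l//.
rewrite (le_trans (ler_normB _ _))// -addrA lerD2l.
have p0 := ctr_gt0 htheta s z1.
have h1 : ln gap <= ln (normc (z - (pd s).1)).
  by rewrite ler_ln ?posrE//; exact: circle_ctr_ge.
have h2 : ln (normc (z - (pd s).1)) <= ln (1 + (cos (theta / 2))^-1).
  rewrite ler_ln ?posrE//; first exact: circle_ctr_le.
  by rewrite addr_gt0// invr_gt0 cos_half_gt0.
have := ler_norm (- ln gap); rewrite normrN.
have := ler_norm (ln (1 + (cos (theta / 2))^-1)).
have := normr_ge0 (ln gap); have := normr_ge0 (ln (1 + (cos (theta / 2))^-1)).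
rewrite ler_norml; lra.
Qed.

Lemma ln_dilation_arc l s z : s != l -> arc l z ->
  ln (dilation theta s z) <= ln contraction.
Proof.
rewrite eq_sym => sl [z1 zl]; have g0 := dilation_gt0 htheta s z1.
rewrite ler_ln ?posrE ?contraction_gt0// ler_wpM2l ?sqr_ge0//.
have sz := normc_disk_ge htheta sl zl.
rewrite lef_pV2 ?posrE ?exprn_gt0 ?ctr_gt0// ler_pXn2r// nnegrE ?normc_ge0//.
exact: ltW.
Qed.

Lemma ln_contraction_lt0 : ln contraction < 0.
Proof. by rewrite ln_lt0// contraction_gt0 contraction_lt1. Qed.

Lemma dilation_powRE s z d : unit_circle z ->
  dilation theta s z `^ d = expR (d * ln (dilation theta s z)).
Proof. by move=> z1; rewrite /powR gt_eqF// dilation_gt0. Qed.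

Definition weight_bound : R := `|delta| * log_dilation_bound.

Lemma weight_le s z : unit_circle z ->
  expR (- weight_bound) <= dilation theta s z `^ delta <= expR weight_bound.
Proof.
move=> z1; rewrite dilation_powRE// !ler_expR -ler_norml normrM.
by rewrite ler_wpM2l// ln_dilation_le.
Qed.

Definition cone (K : R) f := [/\ forall s, bounded_lipschitz (f s),
  forall l z, arc l z -> 0 < f l z &
  forall l x y, arc l x -> arc l y ->
    f l x <= expR (K * normc (x - y)) * f l y].

(** The Lipschitz constant of the logarithm of dilation^delta. *)
Definition distortion : R := `|delta| * (2 / gap).

Lemma transfer_gt0 f l z : (forall l z, arc l z -> 0 < f l z) ->
  arc l z -> 0 < L f l z.
Proof.
move=> f0 zl; rewrite /transfer.
have [s /andP[sl _]] := other_letter l l.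
rewrite (bigD1 s)//= ltr_wpDr ?mulr_gt0 ?powR_gt0 ?dilation_gt0 ?f0//.
- rewrite sumr_ge0// => t /andP[tl _].
  by rewrite mulr_ge0 ?powR_ge0// ltW// f0//; exact: arc_reflection zl.
- exact: arc_circle zl.
- exact: arc_reflection zl.
Qed.

(** Each summand of the transfer operator multiplies f, composed with a
    contraction, by a weight with bounded distortion. *)
Lemma transfer_cone K f : 0 <= K -> cone K f ->
  cone (distortion + contraction * K) (L f).
Proof.
move=> K0 [blf f0 fK]; split.
- by move=> s; exact: bl_transfer.
- by move=> l z; exact: transfer_gt0.
move=> l x y xl yl; rewrite /transfer mulr_sumr; apply: ler_sum => s sl.
have x1 := arc_circle xl; have y1 := arc_circle yl.
have rx := arc_reflection sl xl; have ry := arc_reflection sl yl.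
rewrite mulrDl expRD mulrACA; apply: ler_pM.
- exact: powR_ge0.
- exact/ltW/f0.
- exact: dilation_distortion.
apply: le_trans (fK _ _ _ rx ry) _; rewrite ler_wpM2r ?(ltW (f0 _ _ ry))//.
rewrite ler_expR [contraction * K]mulrC -mulrA ler_wpM2l//.
exact: (arc_contraction sl xl yl).
Qed.

Lemma transfer_le f (C : 'I_3 -> R) l z :
  (forall t z, arc t z -> 0 <= f t z <= C t) -> arc l z ->
  L f l z <= expR weight_bound * \sum_(s | s != l) C s.
Proof.
move=> fC zl; rewrite mulr_sumr; apply: ler_sum => s sl.
have /andP[f0 fc] := fC s _ (arc_reflection sl zl).
apply: ler_pM => //; first exact: powR_ge0.
by have /andP[] := weight_le s (arc_circle zl).
Qed.

Lemma transfer_ge f (C : 'I_3 -> R) l z :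
  (forall t z, arc t z -> 0 <= C t <= f t z) -> arc l z ->
  expR (- weight_bound) * \sum_(s | s != l) C s <= L f l z.
Proof.
move=> fC zl; rewrite mulr_sumr; apply: ler_sum => s sl.
have /andP[f0 fc] := fC s _ (arc_reflection sl zl).
apply: ler_pM => //.
by have /andP[] := weight_le s (arc_circle zl).
Qed.

Lemma arc_nonempty t : exists z, arc t z.
Proof.
have [z1 zt] := radial_proj_cell htheta (isT : reduced [:: t]).
by exists (radial_proj (cell theta [:: t]).1).
Qed.

Definition mixing K : R := 2 * expR (4 * (weight_bound + K)).

(** Two steps of the transfer operator connect any two of the three arcs, so
    that the values of its image are comparable over the whole circle. *)
Lemma transfer2_mixing K f l l' x y : 0 <= K -> cone K f ->
  arc l x -> arc l' y -> L (L f) l x <= mixing K * L (L f) l' y.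
Proof.
move=> K0 [_ f0 fK] xl yl.
have /all_sig[e eP] t := cid (arc_nonempty t).
(* On each arc f is comparable to its value at one point. *)
pose b t := f t (e t); have b0 t : 0 < b t by exact: f0.
have up t z : arc t z -> f t z <= expR (2 * K) * b t.
  move=> zt; rewrite (le_trans (fK _ _ _ zt (eP t)))//.
  rewrite ler_wpM2r ?(ltW (b0 t))// ler_expR mulrC ler_wpM2r//.
  exact: arc_dist zt (eP t).
have low t z : arc t z -> expR (- (2 * K)) * b t <= f t z.
  move=> zt; rewrite expRN ler_pdivrMl ?expR_gt0//.
  rewrite (le_trans (fK _ _ _ (eP t) zt))//.
  rewrite ler_wpM2r ?(ltW (f0 _ _ zt))// ler_expR mulrC ler_wpM2r//.
  exact: arc_dist (eP t) zt.
have f0' t z : arc t z -> 0 < L f t z by exact: transfer_gt0.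
pose B s := \sum_(t | t != s) b t.
have B0 s : 0 <= B s by rewrite sumr_ge0// => t _; exact: ltW.
have up1 s z : arc s z -> L f s z <= expR (weight_bound + 2 * K) * B s.
  move=> zs; rewrite expRD -mulrA mulr_sumr.
  by apply: transfer_le zs => t u ut; rewrite up// ltW ?f0.
have low1 s z : arc s z -> expR (- (weight_bound + 2 * K)) * B s <= L f s z.
  move=> zs; rewrite opprD expRD -mulrA mulr_sumr.
  apply: transfer_ge zs => t u ut; rewrite low// andbT.
  by rewrite mulr_ge0 ?expR_ge0// ltW.
have := transfer_le (fun t z zt => introT andP (conj (ltW (f0' t z zt)) (up1 t z zt))) xl.
have lowc t z : arc t z ->
    0 <= expR (- (weight_bound + 2 * K)) * B t <= L f t z.
  by move=> zt; rewrite low1// mulr_ge0 ?expR_ge0.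
have := transfer_ge lowc yl.
rewrite -!mulr_sumr !mulrA -!expRD => lo hi.
apply: le_trans hi _; rewrite /mixing.
apply: le_trans (_ : 2 * expR (4 * (weight_bound + K)) *
  (expR (- weight_bound - (weight_bound + 2 * K)) * \sum_(s | s != l') B s) <= _).
  rewrite [leRHS](_ : _ = expR (4 * (weight_bound + K)) *
    expR (- weight_bound - (weight_bound + 2 * K)) *
    (2 * \sum_(s | s != l') B s)); last by ring.
  rewrite -expRD.
  have -> : 4 * (weight_bound + K) + (- weight_bound - (weight_bound + 2 * K)) =
      weight_bound + (weight_bound + 2 * K) by ring.
  by rewrite ler_wpM2l ?expR_ge0// sum_two_steps// => t; exact: ltW.
by rewrite ler_wpM2l// mulr_ge0 ?expR_ge0.
Qed.

End cone.

(** * Rigidity of averages *)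

Section rigidity.
Context {R : realType} (theta : R) (htheta : 0 < theta < 2 * pi / 3).
Variable delta : R.
Implicit Types (x y z : R[i]) (s t l : 'I_3).
Implicit Types (f g h : 'I_3 -> R[i] -> R) (M N : ('I_3 -> R[i] -> R) -> R).
Local Notation arc := (arc theta).
Local Notation L := (transfer theta delta).
Local Notation contraction := (contraction theta).
Local Notation distortion := (distortion theta delta).

(** The slope for which one step of the transfer operator gains exactly 1, see
    slope_transfer. *)
Definition slope : R := (distortion + 1) / (1 - contraction).

Local Notation K := slope.
Local Notation A := (mixing theta delta slope).

Let c0 : 0 < contraction. Proof. exact: contraction_gt0. Qed.
Let c1 : contraction < 1. Proof. exact: contraction_lt1. Qed.

Let dist0 : 0 <= distortion.
Proof. by rewrite mulr_ge0// divr_ge0// ltW// circle_gap_gt0. Qed.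

Lemma slope_ge1 : 1 <= K.
Proof. by rewrite /slope ler_pdivlMr; have := c0; have := c1; have := dist0; lra. Qed.

Let K0 : 0 <= K. Proof. exact: le_trans ler01 slope_ge1. Qed.

Lemma slope_transfer : distortion + contraction * K = K - 1.
Proof. by rewrite /slope; field; rewrite subr_eq0 gt_eqF. Qed.

Lemma cone_transfer f : cone theta K f -> cone theta (K - 1) (L f).
Proof. by move=> /(transfer_cone htheta delta K0); rewrite slope_transfer. Qed.

Lemma cone_weaken f : cone theta (K - 1) f -> cone theta K f.
Proof.
move=> [blf f0 fK]; split=> // l x y xl yl; apply: le_trans (fK _ _ _ xl yl) _.
rewrite ler_wpM2r ?(ltW (f0 _ _ yl))// ler_expR ler_wpM2r ?normc_ge0//; lra.
Qed.

Let A_ge1 : 1 <= A.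
Proof.
rewrite /mixing (@le_trans _ _ 2)// ?ler1n// ler_peMr// -expR0 ler_expR.
rewrite mulr_ge0// addr_ge0// mulr_ge0// mulr_ge0//.
Qed.

Let A0 : 0 < A. Proof. exact: lt_le_trans ltr01 A_ge1. Qed.

Lemma cone_cst (a : R) : 0 < a -> cone theta K (fun _ _ => a).
Proof.
move=> a0; split=> // [s|l x y _ _]; first exact: bl_cst.
rewrite ler_peMl ?(ltW a0)// -expR0 ler_expR mulr_ge0 ?normc_ge0//.
Qed.

(** The properties shared by the limit measure and the discrete measure. *)
Definition averaging M : Prop :=
  [/\ forall f g, (forall s, bounded_lipschitz (f s)) -> (forall s, bounded_lipschitz (g s)) ->
        (forall l z, arc l z -> f l z <= g l z) -> M f <= M g,
      forall a, M (fun _ _ => a) = a &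
      forall f a, (forall s, bounded_lipschitz (f s)) -> M (fun s z => f s z + a) = M f + a].

Lemma averaging_transfer2 M f l z : averaging M -> cone theta K f -> arc l z ->
  M (L (L f)) <= A * L (L f) l z /\ L (L f) l z <= A * M (L (L f)).
Proof.
move=> [leM Mc _] cf zl.
have blh : forall s, bounded_lipschitz (L (L f) s).
  by case: (cone_transfer (cone_weaken (cone_transfer cf))).
have mix := transfer2_mixing htheta delta K0 cf.
split.
  rewrite -[leRHS]Mc; apply: leM => // [s|l' x xl]; first exact: bl_cst.
  exact: mix.
rewrite mulrC -ler_pdivrMr// -[leLHS]Mc; apply: leM => // [s|l' x xl].
  exact: bl_cst.
by rewrite ler_pdivrMr// mulrC; exact: mix.
Qed.

(** The share of the mean that is subtracted as a constant after two steps of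
    the transfer operator. It has to be small enough for cone_remainder, where
    exp(-2) comes from the diameter 2 of the circle. *)
Definition share : R := expR (-2) / (A * K).

Let share0 : 0 < share.
Proof. by rewrite divr_gt0 ?expR_gt0// mulr_gt0// (lt_le_trans ltr01 slope_ge1). Qed.

Let shareA : share * A * K = expR (-2).
Proof.
rewrite /share -mulrA divfK// mulf_neq0// gt_eqF//.
exact: lt_le_trans ltr01 slope_ge1.
Qed.

Let shareA_lt1 : share * A < 1.
Proof.
have e2 : expR (-2) < 1 :> R by rewrite expR_lt1; lra.
have := shareA; have := slope_ge1; have : 0 < share * A by rewrite mulr_gt0.
move: (share * A) => u; nra.
Qed.

Let share_lt1 : share < 1.
Proof. by apply: le_lt_trans shareA_lt1; rewrite ler_peMr// ltW. Qed.

(** The gain of 1 in the slope leaves room for the subtraction of a constant.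
    At points at distance t <= 2, the gain is of the order of t, and so is the
    loss caused by the constant. *)
Lemma cone_remainder h m : cone theta (K - 1) h -> 0 < m ->
  (forall l z, arc l z -> m <= A * h l z) ->
  cone theta K (fun l z => h l z - share * m).
Proof.
move=> [blh h0 hK] m0 mh.
have hlow l z : arc l z -> share * m < h l z.
  move=> zl; apply: lt_le_trans (_ : m / A <= _).
    by rewrite ltr_pdivlMr// mulrAC gtr_pMl.
  by rewrite ler_pdivrMr// mulrC mh.
split.
- by move=> s; apply: blD => //; exact: bl_cst.
- by move=> l z zl; rewrite subr_gt0 hlow.
move=> l x y xl yl; set t := normc (x - y).
have t0 : 0 <= t by exact: normc_ge0.
have t2 : t <= 2 by exact: arc_dist xl yl.
have E0 := expR_gt0 (K * t).
have hx : h l x <= expR (K * t) * expR (- t) * h l y.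
  rewrite -expRD (_ : K * t - t = (K - 1) * t); last by ring.
  exact: hK.
have e1 : expR (K * t) - 1 <= K * t * expR (K * t) by exact: expR_sub1_le.
have e2 : t * expR (-2) <= 1 - expR (- t).
  have := @expR_ge1Dx R t; have := expR_gt0 (- t) => et0 et1.
  have : (1 + t) * expR (- t) <= expR t * expR (- t) by rewrite ler_pM2r.
  rewrite -expRD subrr expR0.
  have : t * expR (-2) <= t * expR (- t).
    by rewrite ler_wpM2l// ler_expR lerN2.
  lra.
have key : share * m * (expR (K * t) - 1) <= expR (K * t) * (1 - expR (- t)) * h l y.
  apply: (@le_trans _ _ (expR (K * t) * (t * expR (-2)) * h l y)); last first.
    by rewrite ler_wpM2r ?(ltW (h0 _ _ yl))// ler_wpM2l// ltW.
  apply: (@le_trans _ _ (share * m * (K * t * expR (K * t)))).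
    by rewrite ler_wpM2l// mulr_ge0 ?ltW.
  rewrite (_ : share * m * _ = expR (K * t) * t * (share * K) * m); last by ring.
  rewrite -shareA [leRHS](_ : _ =
    expR (K * t) * t * (share * K) * (A * h l y)); last by ring.
  apply: ler_wpM2l; last exact: mh.
  apply: mulr_ge0; last by rewrite mulr_ge0 ?(ltW share0).
  by rewrite mulr_ge0 ?(ltW E0).
rewrite mulrBr; lra.
Qed.

Section two_averages.
Context (M N : ('I_3 -> R[i] -> R) -> R).
Hypotheses (avM : averaging M) (avN : averaging N).
Hypothesis invM : forall f, cone theta K f -> M (L f) = M f.

Let invM2 f : cone theta K f -> M (L (L f)) = M f.
Proof.
by move=> cf; rewrite invM ?invM//; exact: cone_weaken (cone_transfer cf).
Qed.

Let M_gt0 f : cone theta K f -> 0 < M f.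
Proof.
move=> cf; have [z zl] := arc_nonempty htheta ord0.
have [_] := averaging_transfer2 avM cf zl; rewrite invM2//.
have [_ h0 _] := cone_transfer (cone_weaken (cone_transfer cf)).
by have := h0 _ _ zl => h1 h2; rewrite -(pmulr_rgt0 _ A0) (lt_le_trans h1).
Qed.

Let N_le f : cone theta K f -> N (L (L f)) <= A * M f.
Proof.
move=> cf; have [leN Nc _] := avN.
rewrite -[leRHS]Nc; apply: leN => [s|s|l z zl]; last 2 first.
- exact: bl_cst.
- by have [_] := averaging_transfer2 avM cf zl; rewrite invM2.
by case: (cone_transfer (cone_weaken (cone_transfer cf))).
Qed.

Let N_ge f : cone theta K f -> M f <= A * N (L (L f)).
Proof.
move=> cf; have [leN Nc _] := avN.
rewrite mulrC -ler_pdivrMr// -[leLHS]Nc; apply: leN => [s|s|l z zl].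
- exact: bl_cst.
- by case: (cone_transfer (cone_weaken (cone_transfer cf))).
rewrite ler_pdivrMr// mulrC.
by have [+ _] := averaging_transfer2 avM cf zl; rewrite invM2.
Qed.

Let cone1 : cone theta K (fun _ _ => 1).
Proof. exact: cone_cst. Qed.

Let cone_iter n : cone theta K (iter n (fun f => L (L f)) (fun _ _ => 1)).
Proof.
elim: n => // n IH; rewrite iterS.
by do 2 (apply: cone_weaken; apply: cone_transfer).
Qed.

Let M_iter n : M (iter n (fun f => L (L f)) (fun _ _ => 1)) = 1.
Proof.
elim: n => [|n IH]; first by case: avM => _ ->.
by rewrite iterS invM2.
Qed.

(** Iteration on the constant 1 gives 1 = N 1 <= k^(2n) N (L^(2n) 1), and
    N (L^(2n) 1) is bounded because M (L^(2n) 1) = 1 and the values of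
    L^(2n) 1 are comparable to each other. *)
Lemma multiplier_ge1 (k : R) : 0 <= k ->
  (forall f, cone theta K f -> N f <= k * N (L f)) -> 1 <= k.
Proof.
move=> k0 kN; rewrite leNgt; apply/negP => k1.
(* Two factors k, one for each of the two steps of the operator. *)
have kk : 0 <= k * k < 1 by nra.
(* If k < 1, the mass 1 would be bounded by a null sequence. *)
suff : 1 <= 0 :> R by rewrite ler10.
apply: (@le0_geometric _ (k * k) _ A kk) => n.
have [_ Nc _] := avN.
have : 1 <= (k * k) ^+ n * N (iter n (fun f => L (L f)) (fun _ _ => 1)).
  elim: n => [|n IH]; first by rewrite expr0 mul1r Nc.
  apply: le_trans IH _; rewrite exprSr -mulrA ler_wpM2l//.
    by rewrite exprn_ge0//; lra.
  rewrite -mulrA iterS; apply: le_trans (kN _ (cone_iter n)) _.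
  by rewrite ler_wpM2l// kN//; apply: cone_weaken; exact: cone_transfer.
have kn0 : 0 <= (k * k) ^+ n by rewrite exprn_ge0//; lra.
case: n kn0 => [|n] kn0 /le_trans; apply; first by rewrite Nc ler_wpM2l.
rewrite ler_wpM2l// iterS (le_trans (N_le (cone_iter n)))// M_iter mulr1//.
Qed.

(** Dual to multiplier_ge1, with the lower bound for N (L^(2n) 1). *)
Lemma multiplier_le1 (k : R) : 0 <= k ->
  (forall f, cone theta K f -> k * N (L f) <= N f) -> k <= 1.
Proof.
move=> k0 kN; rewrite leNgt; apply/negP => k1.
have kk : 0 <= (k * k)^-1 < 1.
  by rewrite invr_ge0 mulr_ge0//= invf_lt1; nra.
have kk0 : 0 < k * k by nra.
suff : 1 <= 0 :> R by rewrite ler10.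
apply: (@le0_geometric _ _ _ A kk) => n.
rewrite exprVn mulrC ler_pdivlMr ?exprn_gt0// mul1r.
have [_ Nc _] := avN.
have : (k * k) ^+ n * N (iter n (fun f => L (L f)) (fun _ _ => 1)) <= 1.
  elim: n => [|n IH]; first by rewrite expr0 mul1r Nc.
  apply: le_trans IH; rewrite exprSr -mulrA ler_wpM2l//.
    by rewrite exprn_ge0//; lra.
  rewrite -mulrA iterS; apply: le_trans (kN _ (cone_iter n)).
  by rewrite ler_wpM2l// kN//; apply: cone_weaken; exact: cone_transfer.
have kn0 : 0 <= (k * k) ^+ n by rewrite exprn_ge0//; lra.
case: n kn0 => [|n] kn0 H; first by rewrite expr0.
have := N_ge (cone_iter n); rewrite M_iter => H1.
rewrite (@le_trans _ _ ((k * k) ^+ n.+1 * (A * N (iter n.+1 (fun f => L (L f)) (fun _ _ => 1)))))//.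
  by rewrite ler_peMr.
by rewrite mulrCA ler_piMr// ltW.
Qed.

(** If N is invariant up to a factor exp(tau), then N (L^2 f) and M f differ
    only through the remainder of L^2 f, which lies in the cone and has the
    smaller mean (1 - share) M f. The discrepancies sum up to a geometric series
    with ratio 1 - share. *)
Lemma rigidity (tau : R) f : 0 <= tau ->
  (forall f, cone theta K f ->
     expR (- tau) * N (L f) <= N f <= expR tau * N (L f)) ->
  cone theta K f ->
  `|N f - M f| <= (expR (2 * tau) - 1) * (A * (1 + share^-1)) * M f.
Proof.
move=> tau0 tauN.
set E := expR (2 * tau) - 1.
have E0 : 0 <= E by rewrite subr_ge0 -expR0 ler_expR mulr_ge0.
have NLL g : cone theta K g -> `|N g - N (L (L g))| <= E * (A * M g).
  move=> cg; have cg' := cone_weaken (cone_transfer cg).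
  have /andP[lo hi] := tauN _ cg; have /andP[lo' hi'] := tauN _ cg'.
  have n2 := N_le cg.
  have n0 : 0 <= N (L (L g)).
    by rewrite -(pmulr_rge0 _ A0) (le_trans (ltW (M_gt0 cg)) (N_ge cg)).
  have h1 : N g <= expR (2 * tau) * N (L (L g)).
    rewrite (_ : 2 * tau = tau + tau); last by ring.
    by rewrite expRD -mulrA (le_trans hi)// ler_wpM2l.
  have h2 : expR (- (2 * tau)) * N (L (L g)) <= N g.
    rewrite (_ : - (2 * tau) = - tau - tau); last by ring.
    by rewrite expRD -mulrA (le_trans _ lo)// ler_wpM2l// expR_ge0.
  have h3 : 1 - expR (- (2 * tau)) <= E.
    have e0 : expR (- (2 * tau)) <= 1 by rewrite expR_le1 oppr_le0 mulr_ge0.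
    have : expR (- (2 * tau)) * expR (2 * tau) = 1.
      by rewrite -expRD addNr expR0.
    move: E0; rewrite /E; nra.
  apply: (@le_trans _ _ (E * N (L (L g)))); last by rewrite ler_wpM2l.
  rewrite ler_norml /E; apply/andP; split; last by lra.
  have : (1 - expR (- (2 * tau))) * N (L (L g)) <= E * N (L (L g)).
    by rewrite ler_wpM2r.
  rewrite /E; lra.
have P n g : cone theta K g ->
    `|N (L (L g)) - M g| <= ((1 - share) ^+ n * A + E * A / share) * M g.
  elim: n g => [|n IH] g cg.
    rewrite expr0 mul1r; have m0 := M_gt0 cg; have := N_le cg; have := N_ge cg.
    have eas : 0 <= E * A / share * M g.
      by rewrite mulr_ge0 ?(ltW m0)// divr_ge0 ?(ltW share0)// mulr_ge0 ?(ltW A0).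
    move=> n1 n2; have n0 : 0 <= N (L (L g)).
      by rewrite -(pmulr_rge0 _ A0) (le_trans (ltW m0)).
    have : M g <= A * M g by rewrite ler_peMl// ltW.
    rewrite mulrDl ler_norml; lra.
  have m0 := M_gt0 cg.
  pose g' := fun l z => L (L g) l z - share * M g.
  have ch := cone_transfer (cone_weaken (cone_transfer cg)).
  have cg' : cone theta K g'.
    apply: cone_remainder => // l z zl.
    by have [+ _] := averaging_transfer2 avM cg zl; rewrite invM2.
  have [blh _ _] := ch.
  have Mg' : M g' = (1 - share) * M g.
    by case: avM => _ _ ->//; rewrite invM2//; ring.
  have Ng' : N g' = N (L (L g)) - share * M g by case: avN => _ _ ->.
  have -> : N (L (L g)) - M g = (N g' - N (L (L g'))) + (N (L (L g')) - M g').
    by rewrite Ng' Mg'; ring.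
  apply: le_trans (ler_normD _ _) _.
  apply: le_trans (lerD (NLL _ cg') (IH _ cg')) _.
  rewrite Mg' (_ : E * _ + _ = ((1 - share) ^+ n.+1 * A +
      (E * A / share - E * A * share)) * M g); last first.
    by rewrite exprS; field; rewrite gt_eqF.
  rewrite ler_wpM2r ?(ltW m0)// lerD2l lerBlDr lerDl.
  by rewrite mulr_ge0 ?(ltW share0)// mulr_ge0 ?(ltW A0).
move=> cf; have m0 := M_gt0 cf.
have H : `|N (L (L f)) - M f| <= E * A / share * M f.
  rewrite -subr_le0; apply: (@le0_geometric _ (1 - share) _ (A * M f)).
    by rewrite subr_ge0 ltW//= ltrBlDr ltrDl.
  move=> n; have := P n _ cf; rewrite mulrDl -mulrA; lra.
have -> : N f - M f = (N f - N (L (L f))) + (N (L (L f)) - M f) by ring.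
apply: le_trans (ler_normD _ _) _; apply: le_trans (lerD (NLL _ cf) H) _.
by rewrite le_eqVlt; apply/orP; left; apply/eqP; ring.
Qed.

End two_averages.
End rigidity.

(** * The sample points *)

Section sample.
Context {R : realType} (theta : R) (htheta : 0 < theta < 2 * pi / 3).
Context (eps : R) (W : seq (seq 'I_3)) (stopW : stopping theta eps W).
Implicit Types (x y z : R[i]) (s t l : 'I_3).
Implicit Types (f g : 'I_3 -> R[i] -> R).
Local Notation pd := (primitive_disk theta).
Local Notation rad := (tan (theta / 2)).
Local Notation rho := (reflection theta).
Local Notation arc := (arc theta).
Local Notation P := [seq cell theta w | w <- W].
Local Notation index := 'I_(size P).

Let rad0 : 0 < rad. Proof. exact: rad_gt0. Qed.

(** The default value of nth and, in letter, that of head are never reached. *)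
Definition word (i : index) : seq 'I_3 := nth [::] W i.

Definition letter (i : index) : 'I_3 := head ord0 (word i).

Let ltW_size (i : index) : (i < size W)%N.
Proof. by rewrite -(size_map (cell theta)). Qed.

Lemma tnth_cell (i : index) : tnth (in_tuple P) i = cell theta (word i).
Proof. by rewrite (tnth_nth (0, 0)) /= (nth_map [::]). Qed.

Lemma word_in (i : index) : word i \in W.
Proof. exact: mem_nth. Qed.

Lemma wordP (i : index) : exists t u, word i = [:: letter i, t & u] /\
  reduced [:: letter i, t & u].
Proof.
have [mW _ _] := stopW; have [rw sw _ _] := mW _ (word_in i).
move: rw sw; rewrite /letter; case: (word i) => [|s [|t u]]//= rw _.
by exists t, u.
Qed.

Lemma word_radius (i : index) : (cell theta (word i)).2 < eps.
Proof. by have [mW _ _] := stopW; have [] := mW _ (word_in i). Qed.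

Lemma word_surj w : w \in W -> exists i, word i = w.
Proof.
move=> wW; have iW : (seq.index w W < size P)%N by rewrite size_map index_mem.
by exists (Ordinal iW); rewrite /word nth_index.
Qed.

Lemma word_diverge (i j : index) : i != j -> diverge (word i) (word j).
Proof.
have [_ /(pairwiseP [::]) pW _] := stopW => ij.
have [ltij|ltji|/val_inj eij] := ltngtP i j; last by rewrite eij eqxx in ij.
  by apply: pW => //; rewrite inE.
by rewrite /diverge andbC; apply: pW => //; rewrite inE.
Qed.

Lemma cell_index_inj (i j : index) z : closed_disk (cell theta (word i)) z ->
  closed_disk (cell theta (word j)) z -> i = j.
Proof.
move=> zi zj; apply/eqP; apply: contraT => /word_diverge dij; exfalso.
have [t [u [iE ri]]] := wordP i; have [t' [u' [jE rj]]] := wordP j.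
by apply: (diverge_disjoint htheta _ _ _ _ dij zi zj); rewrite ?iE ?jE.
Qed.

Lemma sample_cell (i : index) :
  unit_circle (sample_point i) /\ closed_disk (cell theta (word i)) (sample_point i).
Proof.
rewrite /sample_point tnth_cell; have [t [u [-> rw]]] := wordP i.
exact: radial_proj_cell.
Qed.

Lemma sample_point_inj : injective (@sample_point R P).
Proof.
move=> i j ij; have [_ zi] := sample_cell i; have [_ zj] := sample_cell j.
by apply: cell_index_inj zi _; rewrite ij.
Qed.

Lemma sample_arc (i : index) : arc (letter i) (sample_point i).
Proof.
have [z1 zi] := sample_cell i; split => //.
by move: zi; have [t [u [-> rw]]] := wordP i; exact: cell_sub_head.
Qed.

Lemma primitive_index_letter (i : index) :
  primitive_index theta (tnth (in_tuple P) i) = letter i.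
Proof.
rewrite tnth_cell; have [t [u [-> rw]]] := wordP i.
exact: primitive_index_cell.
Qed.

(** The relation i |-> j between the cells of the final list. *)
Definition arrow (i j : index) : bool :=
  `[< closed_disk (cell theta (word j)) `<=`
      rho (letter i) @` closed_disk (cell theta (word i)) >].

Lemma mcmullen_entry (i j : index) : mcmullen_matrix theta P i j =
  if arrow i j then dilation theta (letter i) (sample_point j) else 0.
Proof.
rewrite mxE; cbv zeta; rewrite primitive_index_letter !tnth_cell /arrow; case: ifP => // _.
have [z1 _] := sample_cell j.
rewrite angular_deriv_reflection//; last exact: reflection_circle.
rewrite normc_reflection /dilation.
have p0 := ctr_gt0 htheta (letter i) z1; field.
by rewrite !gt_eqF.
Qed.

Lemma arrow_mem (i j : index) : arrow i j ->
  closed_disk (cell theta (word i)) (rho (letter i) (sample_point j)).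
Proof.
move=> /asboolP ij; have [_ zj] := sample_cell j.
by have [y yi <-] := ij _ zj; rewrite reflectionK.
Qed.

Lemma arrow_letter (i j : index) : arrow i j -> letter i != letter j.
Proof.
move=> /asboolP ij; have [_ zj] := sample_cell j.
have := ij _ zj; have [t [u [iE ri]]] := wordP i.
rewrite iE reflection_cell// => /(cell_sub_head htheta (reduced_cons ri)) zt.
have [t' [u' [jE rj]]] := wordP j; move: zj; rewrite jE.
move=> /(cell_sub_head htheta rj) /(primitive_disjoint htheta zt) <-.
by move: ri; rewrite reduced_cons2 => /andP[].
Qed.

Lemma arrow_dist (i j : index) : arrow i j ->
  normc (sample_point i - rho (letter i) (sample_point j)) <= 2 * eps.
Proof.
move=> /arrow_mem; have [_] := sample_cell i; have := word_radius i.
rewrite /closed_disk /=; set a := (cell theta _).1; set r := (cell theta _).2.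
move=> re za ya; have := normc_tri a (sample_point i) (rho (letter i) (sample_point j)).
by rewrite (normc_distC a); lra.
Qed.

(** Both P_i and P_i' contain the point rho_s(z_j), and the cells of the final
    list are disjoint. *)
Lemma arrow_inj (i i' j : index) : arrow i j -> arrow i' j ->
  letter i = letter i' -> i = i'.
Proof.
move=> /arrow_mem ij /arrow_mem i'j ii'; rewrite -ii' in i'j.
exact: cell_index_inj ij i'j.
Qed.

Lemma arrow_surj s (j : index) : s != letter j ->
  exists i, letter i = s /\ arrow i j.
Proof.
move=> sj; have [u [suW u0 rsu uj]] := stopping_preimage htheta stopW (word_in j) sj.
have [i iE] := word_surj suW; have iE' : letter i = s by rewrite /letter iE.
exists i; split => //; apply/asboolP; rewrite iE' iE.
case: u {iE suW} u0 rsu uj => // t u _ rsu uj; rewrite reflection_cell//.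
have [t' [u' [jE rj]]] := wordP j.
by apply: cell_prefix => //; rewrite jE.
Qed.

Section eigenvector.
Context (d : R) (w : 'cV[R]_(size P)).
Hypotheses (d0 : 0 < d) (w_gt0 : forall i, 0 < w i 0) (w_sum : \sum_i w i 0 = 1).
Hypothesis (w_eigen : mx_power (mcmullen_matrix theta P) d *m w = w).

Definition sample_mean f : R := \sum_i w i 0 * f (letter i) (sample_point i).

Lemma averaging_sample_mean : averaging theta sample_mean.
Proof.
split=> [f g _ _ fg|a|f a _].
- apply: ler_sum => i _; rewrite ler_wpM2l ?(ltW (w_gt0 i))//.
  by apply: fg; exact: sample_arc.
- by rewrite /sample_mean -mulr_suml w_sum mul1r.
- rewrite /sample_mean -[X in _ = _ + X]mul1r -w_sum mulr_suml -big_split/=.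
  by apply: eq_bigr => i _; rewrite mulrDr.
Qed.

(** The eigenvector equation, as the invariance of the discrete measure under a
    discretized transfer operator of exponent d. *)
Lemma sample_mean_expand f : sample_mean f =
  \sum_j w j 0 * \sum_(i | arrow i j)
    dilation theta (letter i) (sample_point j) `^ d * f (letter i) (sample_point i).
Proof.
rewrite /sample_mean -{1}w_eigen.
under eq_bigr => i _ do rewrite mxE mulr_suml.
rewrite exchange_big; apply: eq_bigr => j _ /=.
rewrite mulr_sumr [RHS]big_mkcond; apply: eq_bigr => i _ /=.
rewrite mxE mcmullen_entry; case: ifP => _.
  by ring.
by rewrite powR0 ?gt_eqF// !mul0r.
Qed.

(** By arrow_letter, arrow_surj and arrow_inj, letter is a bijection from the
    arrows into j onto the letters other than that of j. *)
Lemma sum_arrow (F : 'I_3 -> R) j :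
  \sum_(i | arrow i j) F (letter i) = \sum_(s | s != letter j) F s.
Proof.
rewrite (partition_big letter (fun s => s != letter j))/=; last first.
  by move=> i; exact: arrow_letter.
apply: eq_bigr => s /arrow_surj[i [il ij]].
rewrite (big_pred1 i) ?il// => i' /=.
apply/andP/eqP => [[i'j /eqP il']|->]; last by rewrite il.
by apply: (arrow_inj i'j ij); rewrite il.
Qed.

Lemma sample_mean_transfer delta f : sample_mean (transfer theta delta f) =
  \sum_j w j 0 * \sum_(i | arrow i j)
    dilation theta (letter i) (sample_point j) `^ delta *
    f (letter i) (rho (letter i) (sample_point j)).
Proof.
apply: eq_bigr => j _; congr (_ * _); rewrite /transfer.
by rewrite -(sum_arrow (fun s => dilation theta s (sample_point j) `^ delta *
    f s (rho s (sample_point j)))).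
Qed.

Section comparison.
Variable delta : R.
Local Notation L := (transfer theta delta).
Local Notation K := (slope theta delta).
Local Notation contr := (contraction theta).
Local Notation logdil := (log_dilation_bound theta).

Let K0 : 0 <= K. Proof. exact: le_trans ler01 (slope_ge1 htheta delta). Qed.

Let eps0 : 0 <= eps.
Proof.
have [i _ | W0] := pickP (fun i : index => true).
  have [t [u [iE ri]]] := wordP i; have [r0 _ _] := cell_geometry htheta ri.
  by have := word_radius i; rewrite iE => /(lt_trans r0)/ltW.
by have := w_sum; rewrite big_pred0// => /eqP; rewrite eq_sym oner_eq0.
Qed.

(** Both points lie in the cell P_i, of radius less than eps. *)
Lemma cone_arrow f (i j : index) : cone theta K f -> arrow i j ->
  f (letter i) (sample_point i) <=
    expR (2 * K * eps) * f (letter i) (rho (letter i) (sample_point j)) /\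
  f (letter i) (rho (letter i) (sample_point j)) <=
    expR (2 * K * eps) * f (letter i) (sample_point i).
Proof.
move=> [_ f0 fK] ij; have zi := sample_arc i.
have yi : arc (letter i) (rho (letter i) (sample_point j)).
  exact: arc_reflection (arrow_letter ij) (sample_arc j).
have e : expR (K * normc (sample_point i - rho (letter i) (sample_point j))) <=
    expR (2 * K * eps).
  rewrite ler_expR [leRHS](_ : _ = K * (2 * eps)); last by ring.
  by rewrite ler_wpM2l// arrow_dist.
split.
  apply: le_trans (fK _ _ _ zi yi) _.
  by rewrite ler_wpM2r ?(ltW (f0 _ _ yi)).
apply: le_trans (fK _ _ _ yi zi) _; rewrite normc_distC.
by rewrite ler_wpM2r ?(ltW (f0 _ _ zi)).
Qed.

Lemma dilation_exponent (i j : index) : dilation theta (letter i) (sample_point j) `^ d =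
  expR ((d - delta) * ln (dilation theta (letter i) (sample_point j))) *
  dilation theta (letter i) (sample_point j) `^ delta.
Proof.
have [z1 _] := sample_cell j.
by rewrite !dilation_powRE// -expRD; congr expR; ring.
Qed.

Lemma sample_mean_le k f : cone theta K f ->
  (forall i j : index, arrow i j ->
    (d - delta) * ln (dilation theta (letter i) (sample_point j)) <= k) ->
  sample_mean f <= expR (2 * K * eps + k) * sample_mean (L f).
Proof.
move=> cf kP; rewrite sample_mean_transfer sample_mean_expand.
rewrite mulr_sumr; apply: ler_sum => j _.
rewrite mulrCA ler_wpM2l ?(ltW (w_gt0 j))//.
rewrite mulr_sumr; apply: ler_sum => i ij.
have [fi _] := cone_arrow cf ij.
have f0 : 0 <= f (letter i) (sample_point i).
  by have [_ /(_ _ _ (sample_arc i))/ltW] := cf.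
rewrite dilation_exponent expRD [leRHS](_ : _ =
  expR k * dilation theta (letter i) (sample_point j) `^ delta *
  (expR (2 * K * eps) * f (letter i) (rho (letter i) (sample_point j)))); last by ring.
apply: ler_pM => //; first by rewrite mulr_ge0 ?expR_ge0 ?powR_ge0.
by rewrite ler_wpM2r ?powR_ge0// ler_expR kP.
Qed.

Lemma sample_mean_ge k f : cone theta K f ->
  (forall i j : index, arrow i j ->
    k <= (d - delta) * ln (dilation theta (letter i) (sample_point j))) ->
  expR (k - 2 * K * eps) * sample_mean (L f) <= sample_mean f.
Proof.
move=> cf kP; rewrite sample_mean_transfer sample_mean_expand.
rewrite mulr_sumr; apply: ler_sum => j _.
rewrite mulrCA ler_wpM2l ?(ltW (w_gt0 j))//.
rewrite mulr_sumr; apply: ler_sum => i ij.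
have [_ fi] := cone_arrow cf ij.
have y0 : 0 <= f (letter i) (rho (letter i) (sample_point j)).
  have [_ f0 _] := cf; apply/ltW/f0.
  exact: arc_reflection (arrow_letter ij) (sample_arc j).
rewrite dilation_exponent expRD [leLHS](_ : _ =
  expR k * dilation theta (letter i) (sample_point j) `^ delta *
  (expR (- (2 * K * eps)) * f (letter i) (rho (letter i) (sample_point j)))); last by ring.
apply: ler_pM; try by rewrite mulr_ge0 ?expR_ge0 ?powR_ge0.
  by rewrite ler_wpM2r ?powR_ge0// ler_expR kP.
by rewrite expRN ler_pdivrMl ?expR_gt0.
Qed.

Section invariant_mean.
Context (M : ('I_3 -> R[i] -> R) -> R).
Hypotheses (avM : averaging theta M)
  (invM : forall f, cone theta K f -> M (L f) = M f).

(** On the arcs that matter the dilation is at most contr < 1. A gap between d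
    and delta would change the mass by a definite factor at each step; only
    the factor exp(2 K eps) is available to compensate for it. *)
Lemma exponent_error : `|d - delta| * - ln contr <= 2 * K * eps.
Proof.
have avN := averaging_sample_mean.
have ln0 := ln_contraction_lt0 htheta.
have lnc (i j : index) : arrow i j ->
    ln (dilation theta (letter i) (sample_point j)) <= ln contr.
  by move=> ij; exact: ln_dilation_arc (arrow_letter ij) (sample_arc j).
case: (ger0P (d - delta)) => dd.
- have : 1 <= expR (2 * K * eps + (d - delta) * ln contr).
    apply: (multiplier_ge1 htheta avM avN invM (expR_ge0 _)) => f cf.
    apply: sample_mean_le => // i j ij; rewrite ler_wpM2l//.
    exact: lnc.
  by rewrite -[X in X <= _]expR0 ler_expR; lra.
- have : expR ((d - delta) * ln contr - 2 * K * eps) <= 1.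
    apply: (multiplier_le1 htheta avM avN invM (expR_ge0 _)) => f cf.
    apply: sample_mean_ge => // i j ij; rewrite ler_wnM2l ?(ltW dd)//.
    exact: lnc.
  by rewrite expR_le1; lra.
Qed.

Definition error_rate : R := 2 * K * (1 + logdil / - ln contr).

Lemma sample_mean_close f : cone theta K f ->
  `|sample_mean f - M f| <= (expR (2 * (error_rate * eps)) - 1) *
    (mixing theta delta K * (1 + (share theta delta)^-1)) * M f.
Proof.
have avN := averaging_sample_mean.
have ln0 := ln_contraction_lt0 htheta.
have H0 : 0 <= logdil.
  by rewrite /log_dilation_bound mulr_ge0// !addr_ge0.
have Ke0 : 0 <= 2 * K * eps by rewrite mulr_ge0// mulr_ge0.
have dd := exponent_error.
have h : `|d - delta| * logdil <= 2 * K * eps * (logdil / - ln contr).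
  rewrite mulrA ler_pdivlMr ?oppr_gt0//.
  by rewrite mulrAC ler_wpM2r.
have lnc (i j : index) : `|(d - delta) * ln (dilation theta (letter i) (sample_point j))| <=
    2 * K * eps * (logdil / - ln contr).
  apply: le_trans h; rewrite normrM ler_wpM2l//.
  by apply: ln_dilation_le => //; have [] := sample_cell j.
have tauE : error_rate * eps = 2 * K * eps + 2 * K * eps * (logdil / - ln contr).
  by rewrite /error_rate; ring.
apply: (rigidity htheta avM avN invM).
  by rewrite tauE addr_ge0// mulr_ge0// divr_ge0// oppr_ge0 ltW.
move=> {}f cf; rewrite tauE; apply/andP; split; last first.
  apply: sample_mean_le => // i j ij.
  exact: le_trans (ler_norm _) (lnc i j).
rewrite opprD addrC; apply: sample_mean_ge => // i j ij.
by have := lnc i j; rewrite ler_norml => /andP[].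
Qed.

End invariant_mean.
End comparison.
End eigenvector.
End sample.

(** * Powers and the six-fold symmetry *)

Section powers.
Context {R : realType}.
Implicit Types (x y z : R[i]) (k m : int).

Lemma circle_exprz_lipschitz k x y : unit_circle x -> unit_circle y ->
  normc (x ^ k - y ^ k) <= `|k|%:~R * normc (x - y).
Proof.
have nat_case (n : nat) (a b : R[i]) : unit_circle a -> unit_circle b ->
    normc (a ^+ n - b ^+ n) <= n%:R * normc (a - b).
  move=> a1 b1; elim: n => [|n IH].
    by rewrite !expr0 subrr Normc.normc0 mul0r.
  have -> : a ^+ n.+1 - b ^+ n.+1 = a * (a ^+ n - b ^+ n) + (a - b) * b ^+ n.
    by rewrite !exprS; ring.
  rewrite (le_trans (le_normcD _ _))// !Normc.normcM normc_prod a1 b1 expr1n.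
  by rewrite mul1r mulr1 -natr1 mulrDl mul1r lerD2r.
case: k => n x1 y1; first by rewrite -!exprnP nat_case.
have inv (a : R[i]) : unit_circle a -> unit_circle a^-1.
  by rewrite /unit_circle /= Normc.normcV => ->; rewrite invr1.
have x0 : x != 0 by rewrite -normc_gt0 x1.
have y0 : y != 0 by rewrite -normc_gt0 y1.
rewrite NegzE -!exprz_inv -!exprnP (le_trans (nat_case _ _ _ (inv _ x1) (inv _ y1)))//.
have -> : x^-1 - y^-1 = (y - x) / (x * y) by field; rewrite x0 y0.
rewrite Normc.normcM Normc.normcV Normc.normcM x1 y1 mulr1 invr1 mulr1.
by rewrite (normc_distC x).
Qed.

Lemma bl_Re_exprz k : bounded_lipschitz (fun z : R[i] => complex.Re (z ^ k)).
Proof.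
apply: (@bl_intro _ _ 1 `|k|%:~R) => [x x1|x y x1 y1].
  by rewrite (le_trans (Re_le_normc _))// normc_exprz x1 exp1rz.
rewrite -ReB (le_trans (Re_le_normc _))//; exact: circle_exprz_lipschitz.
Qed.

Lemma bl_Im_exprz k : bounded_lipschitz (fun z : R[i] => complex.Im (z ^ k)).
Proof.
apply: (@bl_intro _ _ 1 `|k|%:~R) => [x x1|x y x1 y1].
  by rewrite (le_trans (Im_le_normc _))// normc_exprz x1 exp1rz.
rewrite -ImB (le_trans (Im_le_normc _))//; exact: circle_exprz_lipschitz.
Qed.

Lemma zeta6_quadratic : zeta6 ^+ 2 - zeta6 + 1 = 0 :> R[i].
Proof.
have c3 := @cos_third R; have s3 := @sin_third_sqr R.
rewrite /zeta6 /expi c3 expr2; simpc; apply/eqP; rewrite eq_complex /=.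
by move: s3; set s := sin _; rewrite expr2 => s3; apply/andP; split; apply/eqP; lra.
Qed.

(** The power sum of the three cube roots of -1. *)
Definition root_sum k : R[i] := \sum_(j < 3) (zeta6 ^+ (2 * j + 1)) ^ k.

Let zeta6_neq0 : zeta6 != 0 :> R[i].
Proof. by rewrite -normc_gt0 normc_expi. Qed.

(** The three numbers zeta_6^(2j+1) are the cube roots of -1. *)
Lemma root_cube (j : 'I_3) m k :
  (zeta6 ^+ (2 * j + 1)) ^ (3 * m + k) = (-1) ^ m * (zeta6 ^+ (2 * j + 1)) ^ k :> R[i].
Proof.
rewrite expfzDr ?expf_neq0//; congr (_ * _).
rewrite -exprz_exp; congr (_ ^ m); rewrite -exprnP -exprM mulnC exprM.
by rewrite zeta6_cube exprD mulnC exprM sqrr_sign mul1r expr1.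
Qed.

Lemma root_sum0 m : root_sum (3 * m) = 3 * (-1) ^ m.
Proof.
rewrite /root_sum -[3 * m]addr0.
under eq_bigr => j _ do rewrite root_cube expr0z mulr1.
by rewrite sumr_const card_ord mulr_natl.
Qed.

Lemma root_sum1 m : root_sum (3 * m + 1) = 0.
Proof.
rewrite /root_sum; under eq_bigr => j _ do rewrite root_cube expr1z.
rewrite -mulr_sumr !big_ord_recl big_ord0 /= addr0 expr1.
rewrite [zeta6 ^+ (2 * _ + 1)]zeta6_cube.
have -> : zeta6 ^+ (2 * bump 0 1 + 1) = - (zeta6 ^+ 2) :> R[i].
  by rewrite -[(_ + _)%N]/(3 + 2)%N exprD zeta6_cube mulN1r.
have -> : zeta6 + (-1 - zeta6 ^+ 2) = - (zeta6 ^+ 2 - zeta6 + 1) :> R[i] by ring.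
by rewrite zeta6_quadratic oppr0 mulr0.
Qed.

Lemma root_sumN1 m : root_sum (3 * m - 1) = 0.
Proof.
rewrite (_ : 3 * m - 1 = 3 * (m - 1) + 2); last by ring.
rewrite /root_sum; under eq_bigr => j _ do rewrite root_cube -exprnP.
rewrite -mulr_sumr !big_ord_recl big_ord0 /= addr0 expr1.
rewrite [zeta6 ^+ (2 * _ + 1)]zeta6_cube.
have -> : zeta6 ^+ (2 * bump 0 1 + 1) = - (zeta6 ^+ 2) :> R[i].
  by rewrite -[(_ + _)%N]/(3 + 2)%N exprD zeta6_cube mulN1r.
have z3 := @zeta6_cube R; rewrite !exprS expr0 !mulr1 in z3.
have -> : zeta6 ^+ 2 + ((-1) ^+ 2 + (- (zeta6 ^+ 2)) ^+ 2) =
  zeta6 ^+ 2 + 1 + zeta6 * (zeta6 * (zeta6 * zeta6)) :> R[i] by ring.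
rewrite z3 mulrN1.
have -> : zeta6 ^+ 2 + 1 - zeta6 = zeta6 ^+ 2 - zeta6 + 1 :> R[i] by ring.
by rewrite zeta6_quadratic mulr0.
Qed.

Lemma expi_addN (a : R) : expi a + expi (- a) = (2 * cos a)%:C.
Proof.
apply/eqP; rewrite eq_complex /expi /= cosN sinN subrr eqxx andbT.
by rewrite mulr_natl mulr2n.
Qed.

Lemma six_points_sum k (phi : R) :
  \sum_(j < 3) ((zeta6 ^+ (2 * j + 1) * expi phi) ^ k +
               (zeta6 ^+ (2 * j + 1) * expi (- phi)) ^ k) =
  (2 * cos (k%:~R * phi))%:C * root_sum k.
Proof.
rewrite /root_sum mulr_sumr; apply: eq_bigr => j _.
by rewrite !expfzMl !expi_exprz mulrN -mulrDr expi_addN mulrC.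
Qed.

Lemma Re_sum (I : Type) (r : seq I) (F : I -> R[i]) :
  complex.Re (\sum_(i <- r) F i) = \sum_(i <- r) complex.Re (F i).
Proof. by apply: big_morph => // -[a b] [c d]. Qed.

Lemma Im_sum (I : Type) (r : seq I) (F : I -> R[i]) :
  complex.Im (\sum_(i <- r) F i) = \sum_(i <- r) complex.Im (F i).
Proof. by apply: big_morph => // -[a b] [c d]. Qed.

Lemma Re_realM (a : R) z : complex.Re (a%:C * z) = a * complex.Re z.
Proof. by case: z => b c /=; rewrite mul0r subr0. Qed.

Lemma Im_realM (a : R) z : complex.Im (a%:C * z) = a * complex.Im z.
Proof. by case: z => b c /=; rewrite mul0r addr0. Qed.

End powers.

Section six_fold.
Context {R : realType} (theta : R) (htheta : 0 < theta < 2 * pi / 3).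
Context (eps : R) (W : seq (seq 'I_3)) (stopW : stopping theta eps W).
Local Notation P := [seq cell theta w | w <- W].
Context (M : nat) (phi m : nat -> R) (w : 'cV[R]_(size P)).
Hypotheses (phi_range : forall l, (l <= M %/ 6)%N -> 0 < phi l < theta / 2)
  (phi_mono : forall k l, (k < l <= M %/ 6)%N -> phi k < phi l)
  (sample_points : [set sample_point i | i in [set: 'I_(size P)]] =
     \bigcup_(l in [set l | (l <= M %/ 6)%N]) six_points (phi l))
  (weights : forall i l, (l <= M %/ 6)%N ->
     six_points (phi l) (sample_point i) -> w i 0 = m l).

Local Notation tag := ('I_(M %/ 6).+1 * ('I_3 * bool))%type.

(** The six points of the angle phi l, with the sign of the angle as a boolean. *)
Definition tag_point (t : tag) : R[i] :=
  zeta6 ^+ (2 * t.2.1 + 1) * expi (if t.2.2 then phi t.1 else - phi t.1).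

Let tag_le (t : tag) : (t.1 <= M %/ 6)%N.
Proof. by rewrite -ltnS. Qed.

Let phi_pi (t : tag) : phi t.1 \in `[0, pi].
Proof.
have /andP[p0 p1] := phi_range (tag_le t); have /andP[t0 t1] := htheta.
by rewrite in_itv/=; have := pi_gt0 R; lra.
Qed.

(** The cosine decreases on [0, pi], and a point of the circle at angle psi from
    the axis of D_j is in D_j if and only if cos psi >= cos (theta / 2). *)
Lemma tag_point_arc (t : tag) : closed_disk (primitive_disk theta t.2.1) (tag_point t).
Proof.
have /andP[p0 p1] := phi_range (tag_le t); have /andP[t0 t1] := htheta.
have c0 := cos_half_gt0 htheta; have r0 := rad_gt0 htheta.
rewrite /closed_disk /primitive_disk /= /tag_point -mulrBr Normc.normcM.
rewrite normc_zeta6X mul1r normc_leE ?(ltW r0)// ReB ImB /expi.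
have -> : (cos (theta / 2))%:C^-1 = ((cos (theta / 2))^-1)%:C.
  by rewrite fmorphV.
rewrite [complex.Re _]/= [complex.Im _]/= [complex.Re _]/= [complex.Im _]/= subr0.
have cle : cos (theta / 2) < cos (phi t.1).
  rewrite ltr_cos ?phi_pi// in_itv/=; have := pi_gt0 R; lra.
set psi := if _ then _ else _.
have -> : cos psi = cos (phi t.1) by rewrite /psi; case: ifP => // _; rewrite cosN.
have -> : sin psi ^+ 2 = 1 - cos (phi t.1) ^+ 2.
  have -> : sin psi ^+ 2 = sin (phi t.1) ^+ 2.
    by rewrite /psi; case: ifP => // _; rewrite sinN sqrrN.
  by rewrite -(cos2Dsin2 (phi t.1)); ring.
have -> : tan (theta / 2) ^+ 2 = (cos (theta / 2))^-1 ^+ 2 - 1.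
  by rewrite exprVn (cos2_tan2 (lt0r_neq0 c0)); ring.
have h : 1 <= cos (phi t.1) / cos (theta / 2).
  by rewrite ler_pdivlMr// mul1r ltW.
have -> : (cos (phi t.1) - (cos (theta / 2))^-1) ^+ 2 + (1 - cos (phi t.1) ^+ 2) =
   1 - 2 * (cos (phi t.1) / cos (theta / 2)) + (cos (theta / 2))^-1 ^+ 2 by ring.
lra.
Qed.

(** The disk D_j containing the point determines j; the cosine of the remaining
    angle then determines its absolute value, and the sine its sign. *)
Lemma tag_point_inj : injective tag_point.
Proof.
move=> t t' tt'.
have jj : t.2.1 = t'.2.1.
  by apply: (primitive_disjoint htheta (tag_point_arc t)); rewrite tt'; exact: tag_point_arc.
have s0 (u : tag) : 0 < sin (phi u.1).
  have /andP[p0 p1] := phi_range (tag_le u); have /andP[t0 t1] := htheta.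
  by apply: sin_gt0_pi; have := pi_gt0 R; lra.
move: tt'; rewrite /tag_point jj => /mulfI; rewrite -normc_gt0 normc_zeta6X.
move=> /(_ ltr01) E; move: (E) => /(congr1 (@complex.Im _)) /= ss.
move: E => /(congr1 (@complex.Re _)) /=.
have -> : cos (if t.2.2 then phi t.1 else - phi t.1) = cos (phi t.1).
  by case: ifP => // _; rewrite cosN.
have -> : cos (if t'.2.2 then phi t'.1 else - phi t'.1) = cos (phi t'.1).
  by case: ifP => // _; rewrite cosN.
move=> /cos_inj -/(_ (phi_pi _) (phi_pi _)) pp.
have ll : t.1 = t'.1.
  apply: val_inj; have [tt|tt|//] := ltngtP t.1 t'.1.
    by have := phi_mono (introT andP (conj tt (tag_le t'))); rewrite pp ltxx.
  by have := phi_mono (introT andP (conj tt (tag_le t))); rewrite pp ltxx.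
have bb : t.2.2 = t'.2.2.
  move: ss; rewrite ll; have := s0 t'.
  by case: t.2.2; case: t'.2.2 => //; rewrite sinN; lra.
by move: ll jj bb; case: t {ss pp} => l [j b]; case: t' => l' [j' b'] /= -> -> ->.
Qed.

(** Sample points of different cells are different, and so are the points of
    different tags; equality of the two sets of points is therefore a
    bijection between their indices. *)
Lemma sum_six_points (F : R[i] -> R[i]) :
  \sum_i (w i 0)%:C * F (sample_point i) =
  \sum_(l < (M %/ 6).+1) (m l)%:C * \sum_(j < 3)
    (F (zeta6 ^+ (2 * j + 1) * expi (phi l)) +
     F (zeta6 ^+ (2 * j + 1) * expi (- phi l))).
Proof.
have ex t : exists i : 'I_(size P), sample_point i = tag_point t.
  have : (\bigcup_(l in [set l | (l <= M %/ 6)%N]) six_points (phi l)) (tag_point t).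
    exists t.1 => //=; exists t.2.1; rewrite /tag_point.
    by case: t.2.2; [left|right].
  by rewrite -sample_points => -[i _ <-]; exists i.
have /all_sig[g gP] t := cid (ex t).
have bij_g : bijective g.
  apply: inj_card_bij.
    by move=> t t' tt'; apply: tag_point_inj; rewrite -!gP tt'.
  have -> : #|'I_(size P)| = #|codom g|.
    apply: eq_card => i; rewrite inE; apply/esym/codomP.
    have : [set sample_point i | i in [set: 'I_(size P)]] (sample_point i) by exists i.
    rewrite sample_points => -[l /= lM [j zj]].
    have lM' : (l < (M %/ 6).+1)%N by rewrite ltnS.
    case: zj => zj; [exists (Ordinal lM', (j, true))|exists (Ordinal lM', (j, false))];
      by apply: (sample_point_inj htheta stopW); rewrite gP zj.
  exact: leq_image_card.
(* g maps a tag to the index of the cell with that sample point. *)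
rewrite (reindex g) /=; last exact: onW_bij.
have wg t : w (g t) 0 = m t.1.
  apply: weights => //; exists t.2.1; rewrite gP /tag_point.
  by case: t.2.2; [left|right].
transitivity (\sum_(t : tag) (m t.1)%:C * F (tag_point t)).
  by apply: eq_bigr => t _; rewrite wg gP.
rewrite -(pair_bigA _ (fun l jb => (m (nat_of_ord l))%:C * F (tag_point (l, jb)))) /=.
apply: eq_bigr => l _; rewrite -mulr_sumr; congr (_ * _).
rewrite -(pair_bigA _ (fun j b => F (tag_point (l, (j, b))))) /=.
apply: eq_bigr => j _.
by rewrite big_bool.
Qed.

Lemma sum_six_points_exprz k :
  \sum_i (w i 0)%:C * (sample_point i) ^ k =
  (\sum_(l < (M %/ 6).+1) m l * (2 * cos (k%:~R * phi l)))%:C * root_sum k.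
Proof.
rewrite (sum_six_points (fun z => z ^ k)).
under eq_bigr => l _ do rewrite six_points_sum mulrA -rmorphM.
by rewrite -mulr_suml rmorph_sum.
Qed.

End six_fold.

(** * Convergence of the moments *)

Section convergence.
Context {R : realType} (theta : R) (htheta : 0 < theta < 2 * pi / 3).

(** A function of oscillation much smaller than its values is log-Lipschitz of
    slope 1, and the slope of the cone is at least 1. *)
Lemma bl_shift_cone (delta : R) (u : R[i] -> R) : bounded_lipschitz u ->
  exists C : R, cone theta (slope theta delta) (fun _ z => u z + C).
Proof.
move=> blu; have [B [B0 uB uL]] := blu; exists (2 * B + 1).
have K1 := slope_ge1 htheta delta.
have low x : unit_circle x -> B + 1 <= u x + (2 * B + 1).
  by move=> x1; have := uB x x1; rewrite ler_norml; lra.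
split.
- by move=> _; apply: blD => //; exact: bl_cst.
- by move=> l x /arc_circle /low; lra.
move=> l x y /arc_circle x1 /arc_circle y1; set t := normc (x - y).
have t0 : 0 <= t by exact: normc_ge0.
have := @expR_ge1Dx R (slope theta delta * t); set E := expR _ => E1.
have : u x - u y <= B * t by exact: le_trans (ler_norm _) (uL _ _ x1 y1).
have ly := low _ y1; set v := u y + _ in ly *.
have : (1 + slope theta delta * t) * v <= E * v by rewrite ler_wpM2r//; lra.
have : B * t <= slope theta delta * t * v.
  rewrite mulrAC [leRHS]mulrC [leRHS]mulrC ler_wpM2r//; nra.
rewrite /v; lra.
Qed.

Context (mu : probability (borelC R) R) (hmu : is_limit_measure theta mu).

Local Notation mean_family := (fun f => mean theta mu (glue theta f)).

Lemma averaging_mean : averaging theta mean_family.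
Proof.
have [mu0 _] := hmu; split.
- by move=> f g; exact: le_mean_glue.
- exact: mean_glue_cst.
- by move=> f a; exact: mean_glueD.
Qed.

(** The function u is shifted into the cone by a constant, which has the same
    average for both measures. The resulting factor exp(h) - 1, with h of the
    order of eps, is linear in eps for bounded h. *)
Lemma sample_mean_cvg (u : R[i] -> R) : bounded_lipschitz u ->
  exists2 C : R, 0 <= C & forall (eps : R) (W : seq (seq 'I_3)) (d : R)
    (w : 'cV[R]_(size [seq cell theta w | w <- W])), eps < 1 ->
    stopping theta eps W -> 0 < d -> (forall i, 0 < w i 0) ->
    \sum_i w i 0 = 1 ->
    mx_power (mcmullen_matrix theta [seq cell theta w | w <- W]) d *m w = w ->
    `|\sum_i w i 0 * u (sample_point i) - \int[mu]_(z in unit_circle) u z|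
      <= C * eps.
Proof.
move=> blu; have [mu0 [delta _ conf]] := hmu.
have avM := averaging_mean.
have invM f : cone theta (slope theta delta) f ->
    mean_family (transfer theta delta f) = mean_family f.
  by move=> [blf _ _]; exact: mean_transfer.
have [c cf] := bl_shift_cone delta blu.
pose rate := error_rate theta delta.
pose D := mixing theta delta (slope theta delta) * (1 + (share theta delta)^-1).
pose m0 := mean_family (fun _ z => u z + c).
exists (`|2 * rate| * expR `|2 * rate| * `|D * m0|).
  by rewrite !mulr_ge0 ?expR_ge0.
move=> eps W d w eps1 stopW d0 w0 w1 weig.
have eps0 : 0 <= eps.
  have [i _ | W0] := pickP (fun i : 'I_(size [seq cell theta w | w <- W]) => true).
    have [t [v [iE ri]]] := wordP stopW i.
    have [r0 _ _] := cell_geometry htheta ri.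
    by have := word_radius stopW i; rewrite iE => /(lt_trans r0)/ltW.
  by have := w1; rewrite big_pred0// => /eqP; rewrite eq_sym oner_eq0.
have := sample_mean_close htheta stopW d0 w0 w1 weig avM invM cf.
have -> : sample_mean w (fun _ z => u z + c) =
    \sum_i w i 0 * u (sample_point i) + c.
  rewrite -[X in _ = _ + X]mul1r -w1 mulr_suml -big_split/=.
  by apply: eq_bigr => i _; rewrite mulrDr.
rewrite mean_glueD// mean_glue_circle// opprD addrACA subrr addr0.
move=> /le_trans; apply; rewrite -/rate -/D.
have -> : \int[mu]_(z in unit_circle) u z + c = m0.
  by rewrite -(mean_glue_circle htheta mu0 blu) -(mean_glueD htheta mu0).
rewrite [leRHS](_ : _ = `|2 * rate| * expR `|2 * rate| * eps * `|D * m0|); last by ring.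
rewrite -mulrA; apply: le_trans (ler_norm _) _; rewrite normrM ler_wpM2r//.
set h := 2 * (rate * eps).
(* Linearization of exp(h) - 1, for eps < 1. *)
have he : `|h| = `|2 * rate| * eps by rewrite /h mulrA normrM (ger0_norm eps0).
have hle : expR `|h| <= expR `|2 * rate|.
  by rewrite ler_expR he ler_piMr// ltW.
have h0 : `|expR h - 1| <= `|h| * expR `|h|.
  rewrite ler_norml; apply/andP; split.
    have := expR_ge1Dx h; have := ler_norm (- h); rewrite normrN.
    have : 1 <= expR `|h| by rewrite -expR0 ler_expR.
    have := normr_ge0 h; nra.
  apply: le_trans (expR_sub1_le _) _.
  apply: le_trans (_ : `|h| * expR h <= _).
    by rewrite ler_wpM2r ?expR_ge0// ler_norm.
  by rewrite ler_wpM2l// ler_expR ler_norm.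
apply: le_trans h0 _.
apply: le_trans (_ : `|h| * expR `|2 * rate| <= _); first by rewrite ler_wpM2l.
by rewrite he mulrAC.
Qed.

End convergence.

Section moments.
Context {R : realType} (theta : R) (htheta : 0 < theta < 2 * pi / 3).
Context (mu : probability (borelC R) R) (hmu : is_limit_measure theta mu).
Context (M : R -> nat) (phi m : R -> nat -> R)
  (hout : \forall eps \near 0^'+,
     mcmullen_output theta eps (M eps) (phi eps) (m eps)).

(** The weighted sum of the k-th powers of the sample points, see
    sum_six_points_exprz. *)
Definition sample_sum (k : int) (eps : R) : R[i] :=
  (\sum_(l < (M eps %/ 6).+1) m eps l * (2 * cos (k%:~R * phi eps l)))%:C * root_sum k.

(** T stands for the real or the imaginary part. *)
Lemma near_sample_sum (T : R[i] -> R) (k : int) :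
  bounded_lipschitz (fun z => T (z ^ k)) ->
  (forall (I : Type) (r : seq I) (F : I -> R[i]),
     T (\sum_(i <- r) F i) = \sum_(i <- r) T (F i)) ->
  (forall (a : R) z, T (a%:C * z) = a * T z) ->
  T (sample_sum k eps) @[eps --> 0^'+] --> \int[mu]_(z in unit_circle) T (z ^ k).
Proof.
move=> blT Tsum TM; have [C C0 HC] := sample_mean_cvg htheta hmu blT.
apply/cvgrPdist_lt => e e0; near=> eps.
have eps1 : eps < 1 by near: eps; exact: nbhs_right_lt.
have epsC : eps < e / (C + 1).
  by near: eps; apply: nbhs_right_lt; rewrite divr_gt0// ltr_wpDl.
have eps0 : 0 < eps by near: eps; exact: nbhs_right_gt.
have : mcmullen_output theta eps (M eps) (phi eps) (m eps) by near: eps.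
move=> [P [d [w [[fin _] [d0 _] [weig w0 w1] [phir phim] [sp wm]]]]].
have [W PW stopW] := final_listP htheta fin.
move: w weig w0 w1 sp wm; rewrite PW => w weig w0 w1 sp wm {fin}.
have := HC eps W d w eps1 stopW d0 w0 w1 weig.
have -> : \sum_i w i 0 * T (sample_point i ^ k) = T (sample_sum k eps).
  rewrite /sample_sum -(sum_six_points_exprz htheta stopW phir phim sp wm) Tsum.
  by apply: eq_bigr => i _; rewrite TM.
rewrite distrC => /le_lt_trans; apply.
move: epsC; rewrite ltr_pdivlMr ?ltr_wpDl//; lra.
Unshelve. all: by end_near. Qed.

Lemma Re_moment (s : int) : complex.Re (sample_sum (- s) eps) @[eps --> 0^'+] -->
  complex.Re (moment mu s).
Proof. exact: near_sample_sum (bl_Re_exprz _) (@Re_sum R) (@Re_realM R). Qed.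

Lemma Im_moment (s : int) : complex.Im (sample_sum (- s) eps) @[eps --> 0^'+] -->
  complex.Im (moment mu s).
Proof. exact: near_sample_sum (bl_Im_exprz _) (@Im_sum R) (@Im_realM R). Qed.

Lemma moment_eq0 (s : int) : root_sum (- s) = 0 :> R[i] -> moment mu s = 0.
Proof.
move=> r0; have cst0 (T : R[i] -> R) : T 0 = 0 ->
    T (sample_sum (- s) eps) @[eps --> 0^'+] --> (0 : R).
  move=> T0; rewrite (_ : (fun _ => _) = fun=> 0); first exact: cvg_cst.
  by apply/funext => eps; rewrite /sample_sum r0 mulr0.
apply/eqP; rewrite eq_complex; apply/andP; split; apply/eqP.
  by apply: cvg_unique (Re_moment (s := s)) (cst0 _ _).
by apply: cvg_unique (Im_moment (s := s)) (cst0 _ _).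
Qed.

End moments.

Theorem proposition3p2 (R : realType) (theta : R)
    (htheta : 0 < theta < 2 * pi / 3)
    (mu : probability (borelC R) R) (hmu : is_limit_measure theta mu)
    (M : R -> nat) (phi m : R -> nat -> R)
    (hout : \forall eps \near 0^'+,
       mcmullen_output theta eps (M eps) (phi eps) (m eps))
    (j : int) :
  let partial_sum (eps : R) : R :=
    \sum_(0 <= l < (M eps %/ 6).+1)
      6 * m eps l * cos ((3 * j)%:~R * phi eps l) in
  [/\ moment mu (3 * j - 1) = 0,
      moment mu (3 * j + 1) = 0,
      cvg (partial_sum eps @[eps --> 0^'+]) &
      moment mu (3 * j) =
        ((-1) ^ j * lim (partial_sum eps @[eps --> 0^'+]))%:C].
Proof.
move=> partial_sum.
have signK : (-1) ^ j * (-1) ^ j = 1 :> R.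
  by rewrite -expfzMl mulrNN mulr1 exp1rz.
have sumE eps : sample_sum M phi m (- (3 * j)) eps =
    ((-1) ^ j * partial_sum eps)%:C.
  rewrite /sample_sum -mulrN root_sum0 /partial_sum big_mkord.
  have -> : (-1) ^ (- j) = ((-1) ^ j)%:C :> R[i].
    by rewrite -exprz_inv invrN1 rmorphXz ?rmorphN1//= unitrN1.
  rewrite -(rmorph_nat (real_complex R)) -!rmorphM/=; congr (_%:C).
  rewrite mulrC -mulrA mulrC -mulrA; congr (_ * _).
  rewrite mulr_suml; apply: eq_bigr => l _.
  by rewrite mulrN rmorphN/= mulNr cosN; ring.
have cre : partial_sum eps @[eps --> 0^'+] -->
    (-1) ^ j * complex.Re (moment mu (3 * j)).
  rewrite (_ : partial_sum = fun eps =>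
    (-1) ^ j * complex.Re (sample_sum M phi m (- (3 * j)) eps)).
    by apply: cvgMr; exact: (Re_moment htheta hmu hout (s := 3 * j)).
  by apply/funext => eps; rewrite sumE [complex.Re _]/= mulrA signK mul1r.
(* The sample sums of exponent 3 j are real. *)
have im0 : complex.Im (moment mu (3 * j)) = 0.
  apply: cvg_unique (Im_moment htheta hmu hout (s := 3 * j)) _ => //.
  rewrite (_ : (fun eps => _) = fun=> 0); first exact: cvg_cst.
  by apply/funext => eps; rewrite sumE.
split.
- apply: (moment_eq0 htheta hmu hout).
  rewrite (_ : - (3 * j - 1) = 3 * - j + 1); last by ring.
  exact: root_sum1.
- apply: (moment_eq0 htheta hmu hout).
  rewrite (_ : - (3 * j + 1) = 3 * - j - 1); last by ring.
  exact: root_sumN1.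
- by apply/cvg_ex; exists ((-1) ^ j * complex.Re (moment mu (3 * j))).
- rewrite (cvg_lim _ cre)// mulrA signK mul1r.
  by move: im0; case: (moment mu (3 * j)) => a b /= ->.
Qed.
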